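(* Let $\mathcal H$ be a separable Hilbert space. If $T=(T_1,\ldots,T_n)\in B(\mathcal H)^n$, then there exists a weighted left multi-shift $W=(W_1,\ldots,W_n)$ associated with some strictly positive weights $\boldsymbol\mu=\{\mu_\beta\}_{\beta\in\mathbb F_n^+}$ ($\mu_{g_0}=1$) satisfying, for every $i\in\{1,\ldots,n\}$, $$\sup_{\alpha\in\mathbb F_n^+}\mu_{g_i\alpha}<\infty\quad\text{and}\quad\sup_{\alpha\in\mathbb F_n^+}\frac{\boldsymbol\mu(\alpha g_i,g_0)}{\boldsymbol\mu(\alpha,g_0)}<\infty,$$ and $r(W)=r(T)$, and such that the map $\Psi_T:F^\infty(\boldsymbol\mu)\to B(\mathcal H)$ defined by $$\Psi_T(\varphi(W))=\varphi(T):=\text{SOT-}\lim_{N\to\infty}\sum_{|\alpha|\le N}\Big(1-\frac{|\alpha|}{N+1}\Big)c_\alpha T_\alpha,$$ where $\varphi(W)\in F^\infty(\boldsymbol\mu)$ has the Fourier representation $\sum_{\alpha}c_\alpha W_\alpha$, has the following properties: (i) $\Psi_T\big(\sum_{|\alpha|\le m}c_\alpha W_\alpha\big)=\sum_{|\alpha|\le m}c_\alpha T_\alpha$ for $m\in\mathbb N$; (ii) $\Psi_T$ is sequentially WOT-continuous (resp. SOT-continuous); (iii) $\Psi_T$ is a completely bounded algebra homomorphism and $\|\Psi_T\|_{cb}\le\big\|\sum_{k=0}^\infty\sum_{|\alpha|=k}\frac1{\boldsymbol\mu(\alpha,g_0)^2}T_\alpha T_\alpha^*\big\|^{1/2}$;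 (iv) $\Psi_T$ is $w^*$-continuous; (v) $r(\varphi(T))\le r(\varphi(W))$ for any $\varphi(W)\in F^\infty(\boldsymbol\mu)$; and moreover $\|\Psi_T\|_{cb}\le\frac{\pi}{\sqrt6}$. When $T$ is a nilpotent $n$-tuple of order $m\ge2$, we have $$\|\Psi_T\|_{cb}\le\sqrt{\sum_{k=0}^{m-1}\frac1{(k+1)^2}}.$$
   Context: $\mathbb F_n^+$ is the unital free semigroup on generators $g_1,\ldots,g_n$ with identity $g_0$; $|\alpha|$ is the length of $\alpha$. $F^2(H_n)$ is the full Fock space, a Hilbert space with orthonormal basis $\{e_\alpha\}_{\alpha\in\mathbb F_n^+}$. For operators, $T_\alpha:=T_{i_1}\cdots T_{i_k}$ if $\alpha=g_{i_1}\cdots g_{i_k}$, $T_{g_0}:=I$. $\boldsymbol\mu(\alpha,g_0):=\mu_{g_{i_1}\cdots g_{i_k}}\mu_{g_{i_2}\cdots g_{i_k}}\cdots\mu_{g_{i_k}}$ for $\alpha=g_{i_1}\cdots g_{i_k}$ and $\boldsymbol\mu(g_0,g_0)=1$. The weighted left multi-shift associated with $\boldsymbol\mu$ is $W_ie_\alpha=\mu_{g_i\alpha}e_{g_i\alpha}$ on $F^2(H_n)$. The noncommutative Hardy algebra $F^\infty(\boldsymbol\mu)\subset B(F^2(H_n))$ consists of all operators $\varphi(W)$ obtained as follows: $\varphi=\sum_\alpha c_\alpha Z_\alpha$ is a formal power series such that for every $p\in\mathrm{span}\{e_\alpha\}$ one has $\sum_\alpha c_\alpha W_\alpha p\in F^2(H_n)$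 and $\|\sum_\alpha c_\alpha W_\alpha p\|\le M\|p\|$ for some constant $M$ independent of $p$; $\varphi(W)$ is the unique bounded extension, and $\sum_\alpha c_\alpha W_\alpha$ is its Fourier representation. $F^\infty(\boldsymbol\mu)$ equals the $w^*$-closure of the polynomials in $W_1,\ldots,W_n,I$. For an $n$-tuple, $r(T):=\lim_k\|\sum_{|\alpha|=k}T_\alpha T_\alpha^*\|^{1/2k}$ (joint spectral radius); for a single operator $r$ is the usual spectral radius. $T$ is nilpotent of order (index) $m$ if $m$ is the smallest natural number with $T_\alpha=0$ for all $|\alpha|=m$. *)

(* Defs.v *)
From HB Require Import structures.
From mathcomp Require Import all_boot all_order all_algebra.
From mathcomp Require Import all_classical all_reals all_analysis.
From mathcomp Require Import complex.

Set Implicit Arguments.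
Unset Strict Implicit.
Unset Printing Implicit Defensive.

Import Order.TTheory GRing.Theory Num.Theory.
Import numFieldNormedType.Exports.

Local Open Scope classical_set_scope.
Local Open Scope ring_scope.
Local Open Scope complex_scope.

(* The scalar product is linear in its first argument and conjugate-linear in
   the second one. *)
Record hilbert (R : realType) := Hilbert {
  hilbert_space :> completeNormedModType R[i];
  hdot : {dot hilbert_space for Num.conj};
  hdot_norm : forall x : hilbert_space, `|x| ^+ 2 = hdot x x }.

Definition separable (T : topologicalType) :=
  exists2 D : set T, countable D & dense D.

Definition lspan (K : numFieldType) (V : lmodType K) (S : set V) : set V :=
  [set p | exists (k : nat) (c : 'I_k -> K) (v : 'I_k -> V),
             (forall j, S (v j)) /\ p = \sum_(j < k) c j *: v j].

(* A word of the free semigroup on n generators is a sequence over 'I_n, the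
   empty word being the identity g_0.  The full Fock space is taken up to
   unitary equivalence, as a Hilbert space together with an orthonormal basis
   indexed by the words. *)
Record fockSpace (R : realType) (n : nat) := FockSpace {
  fock_hilbert :> hilbert R;
  fvec : seq 'I_n -> fock_hilbert;
  fvec_orthonormal : forall a b,
    hdot fock_hilbert (fvec a) (fvec b) = (a == b)%:R;
  fvec_total : dense (lspan (range fvec)) }.

Section Operators.
Variable R : realType.
Implicit Types E : hilbert R.

(* The norm of a normed space over R[i] takes its values in R[i]. *)
Definition rnorm (V : normedModType R[i]) (x : V) : R := complex.Re `|x|.

Definition bounded_op E (A : E -> E) :=
  linear A /\ exists M : R, forall x, rnorm (A x) <= M * rnorm x.

Definition opnorm E (A : E -> E) : \bar R :=
  ereal_sup [set (rnorm (A x))%:E | x in [set x | rnorm x <= 1]].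

(* The adjoint of A, when it exists (as for every bounded operator). *)
Definition adjoint E (A : E -> E) : E -> E :=
  xget (fun=> 0) [set B | forall x y, hdot E (A x) y = hdot E x (B y)].

Definition spectrum E (A : E -> E) : set R[i] :=
  [set l | ~ exists B : E -> E, [/\ bounded_op B,
             forall x, B (l *: x - A x) = x &
             forall x, l *: B x - A (B x) = x]].

(* The supremum of the empty set, which occurs if E = 0, is 0. *)
Definition spectral_radius E (A : E -> E) : R :=
  sup [set complex.Re `|l| | l in spectrum A].

(* Convergence of a filter of operators (hence of nets and sequences). *)
Definition sot_cvg E (F : set_system (E -> E)) (A : E -> E) :=
  forall x, B x @[B --> F] --> A x.

Definition wot_cvg E (F : set_system (E -> E)) (A : E -> E) :=
  forall x y,
    (hdot E (B x) y : R[i]^o) @[B --> F] --> (hdot E (A x) y : R[i]^o).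

Definition square_summable E (x : nat -> E) :=
  cvgn (series (fun j => rnorm (x j) ^+ 2)).

(* The w*-topology of B(E), the dual of the trace class operators, is the
   ultraweak topology: every trace class operator is a sum of rank one
   operators < _ , y_j> x_j for square-summable sequences x and y, and it is
   identified with the following functional. *)
Definition normal_functional E (x y : nat -> E) (A : E -> E) : R[i]^o :=
  limn (series (fun j => hdot E (A (x j)) (y j) : R[i]^o)).

Definition wstar_cvg E (F : set_system (E -> E)) (A : E -> E) :=
  forall x y, square_summable x -> square_summable y ->
    normal_functional x y B @[B --> F] --> normal_functional x y A.

(* The norm of the operator matrix A acting on the k-fold direct sum of E. *)
Definition mxopnorm E (k : nat) (A : 'M[E -> E]_k) : \bar R :=
  ereal_sup
    [set (Num.sqrt (\sum_(i < k) rnorm (\sum_(j < k) A i j (x j)) ^+ 2))%:E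
       | x in [set x : 'I_k -> E | \sum_(j < k) rnorm (x j) ^+ 2 <= 1]].

Section Maps.
Variables E H : hilbert R.
Variables (D : set (E -> E)) (Psi : (E -> E) -> (H -> H)).

Definition cbnorm : \bar R :=
  ereal_sup [set r | exists k (A : 'M[E -> E]_k),
    [/\ forall i j, D (A i j), (mxopnorm A <= 1)%E &
        r = mxopnorm (map_mx Psi A)]].

Definition algebra_hom_on :=
  [/\ forall (l : R[i]) A B, D A -> D B -> Psi (l *: A + B) = l *: Psi A + Psi B,
      forall A B, D A -> D B -> Psi (A \o B) = Psi A \o Psi B &
      Psi id = id].

Definition seq_wot_continuous_on :=
  forall (u : nat -> E -> E) A, (forall k, D (u k)) -> D A ->
    wot_cvg (u @ \oo) A -> wot_cvg ((Psi \o u) @ \oo) (Psi A).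

Definition seq_sot_continuous_on :=
  forall (u : nat -> E -> E) A, (forall k, D (u k)) -> D A ->
    sot_cvg (u @ \oo) A -> sot_cvg ((Psi \o u) @ \oo) (Psi A).

Definition wstar_continuous_on :=
  forall (F : set_system (E -> E)) A, ProperFilter F -> F D -> D A ->
    wstar_cvg F A -> wstar_cvg (Psi @ F) (Psi A).

End Maps.

Section Tuples.
Variables (n : nat) (E : hilbert R) (T : 'I_n -> E -> E).

Definition opword (a : seq 'I_n) : E -> E := foldr (fun i A => T i \o A) id a.

Definition opseries (c : seq 'I_n -> R[i]) (N : nat) : E -> E :=
  \sum_(k < N.+1) \sum_(a : k.-tuple 'I_n) c a *: opword a.

Definition cesaro (c : seq 'I_n -> R[i]) (N : nat) : E -> E :=
  opseries (fun a => (1 - (size a)%:R / N.+1%:R) * c a) N.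

Definition row_square (w : seq 'I_n -> R[i]) (k : nat) : E -> E :=
  \sum_(a : k.-tuple 'I_n) w a *: (opword a \o adjoint (opword a)).

Definition joint_radius : \bar R :=
  limn (fun k => poweR (opnorm (row_square (fun=> 1) k)) (k.*2%:R^-1)).

Definition nilpotent_of_order (m : nat) :=
  (forall a, size a = m -> opword a = (fun=> 0)) /\
  (forall k, (k < m)%N -> exists2 a, size a = k & opword a <> (fun=> 0)).

End Tuples.

Section Weights.
Variables (n : nat) (mu : seq 'I_n -> R).

Fixpoint bmu (a : seq 'I_n) : R :=
  if a is i :: a' then mu a * bmu a' else 1.

Definition admissible_weights :=
  [/\ mu [::] = 1, forall a, 0 < mu a &
      forall i, has_ubound (range (fun a => mu (i :: a))) /\
                has_ubound (range (fun a => bmu (rcons a i) / bmu a))].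

Definition weighted_shift (F : fockSpace R n) (W : 'I_n -> F -> F) :=
  forall i, bounded_op (W i) /\
    forall a, W i (fvec F a) = (mu (i :: a))%:C *: fvec F (i :: a).

End Weights.

Section Hardy.
Variables (n : nat) (F : fockSpace R n) (W : 'I_n -> F -> F).

(* A is the bounded extension phi(W) of p |-> sum_a c_a W_a p.  For p in the
   span of the basis this series has its terms c_a W_a e_b pairwise orthogonal
   for each b, so that its summation by increasing length is immaterial. *)
Definition fourier_rep (c : seq 'I_n -> R[i]) (A : F -> F) :=
  bounded_op A /\
  forall p, lspan (range (fvec F)) p -> opseries W c N p @[N --> \oo] --> A p.

Definition hardy_algebra : set (F -> F) := [set A | exists c, fourier_rep c A].

Definition functional_calculus (H : hilbert R) (T : 'I_n -> H -> H)
    (Psi : (F -> F) -> (H -> H)) :=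
  forall c A, fourier_rep c A ->
    bounded_op (Psi A) /\ sot_cvg (cesaro T c @ \oo) (Psi A).

End Hardy.

End Operators.

(* Main.v *)
(** The weights are taken to depend on the length of a word only, so that
bmu(a) = m |a| for a positive sequence m with m (k + j) <= m k * m j.  With
b_k = ||sum_{|a| = k} T_a T_a^*||^(1/2), which is submultiplicative, put
m k = (k + 1) b_k; if some b_k vanishes, a superexponentially small
submultiplicative majorant of (k + 1) b_k is used instead.  For the shift W,
||sum_{|a| = k} W_a W_a^*||^(1/2) = m k, whence r(W) = r(T).

Since phi(W) e_0 = sum_a c_a m |a| e_a, one has phi(T) h = calc h (phi(W) e_0)
where calc h v = sum_a <v, e_a> / m |a| T_a h.  Seen as a row operator, this
bilinear map is controlled by
sum_k b_k^2 / (m k)^2 <= sum_k 1 / (k + 1)^2 = pi^2 / 6.  Applying this to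
matrices, after expanding the arguments h_1, ..., h_k in an orthonormal basis of
their span, bounds the cb norm.  By Riesz' theorem <calc h v, y> = <v, u> for
some u in the Fock space, so <Psi A h, y> = <A e_0, u>, and the weak continuity
statements are immediate.  Finally the Hardy algebra is the commutant of the
weighted right shifts, hence inverse closed, so the spectrum of Psi A is
contained in that of A. *)

Require Import Defs.
From HB Require Import structures.
From mathcomp Require Import all_boot all_order all_algebra.
From mathcomp Require Import all_classical all_reals all_analysis.
From mathcomp Require Import complex ring lra.

Set Implicit Arguments.
Unset Strict Implicit.
Unset Printing Implicit Defensive.

Import Order.TTheory GRing.Theory Num.Theory.
Import numFieldNormedType.Exports.

Local Open Scope classical_set_scope.
Local Open Scope ring_scope.
Local Open Scope complex_scope.

(** * The real-valued norm of a complex normed space *)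

Section RealNorm.
Variable R : realType.
Implicit Types V : normedModType R[i].

(** Three demands lead to the factor k + 1 in the weights: it is submultiplicative, its k-th root
    tends to 1, so that the joint radius does not see it, and its inverse squares are summable.
    Weights depending on the length alone make the left and the right shifts bounded by one
    estimate, m (k + 1) / m k <= m 1, and so provide the right shifts of the commutant argument. All
    estimates of the calculus hold for any constant C subject to [weighted_row_le]. The three cb
    bounds are one bound, with C equal to pi^2 / 6, to the norm of the strong limit of the weighted
    row sums, and to the truncated sum when T is nilpotent. Positivity of operators is only used
    through the quadratic forms sum_a w_a |T_a^* y|^2. Multiplicativity is the identity calc h (A v)
    = calc (calc h v) (A e_0): both sides are bounded and linear in v, and at v = e_b both are the
    sum of the c_a T_a T_b h, divided by m |b|. *)

Lemma rnormE V (x : V) : (rnorm x)%:C = `|x|.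
Proof. by rewrite /rnorm RRe_real// ger0_real. Qed.

Lemma rnormcE (a : R[i]) : (rnorm (a : R[i]^o))%:C = `|a|.
Proof. exact: rnormE. Qed.

Lemma rnorm_ge0 V (x : V) : 0 <= rnorm x.
Proof. by rewrite -ler0c rnormE. Qed.

Lemma rnorm0 V : rnorm (0 : V) = 0.
Proof. by rewrite /rnorm normr0. Qed.

Lemma rnorm_eq0 V (x : V) : rnorm x = 0 -> x = 0.
Proof. by move=> x0; apply/normr0_eq0; rewrite -rnormE x0. Qed.

Lemma rnorm_le0 V (x : V) : rnorm x <= 0 -> x = 0.
Proof. by move=> x0; apply/rnorm_eq0/le_anti; rewrite x0 rnorm_ge0. Qed.

Lemma rnormD V (x y : V) : rnorm (x + y) <= rnorm x + rnorm y.
Proof. by rewrite -lecR rmorphD/= !rnormE ler_normD. Qed.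

Lemma rnormN V (x : V) : rnorm (- x) = rnorm x.
Proof. by rewrite /rnorm normrN. Qed.

Lemma rdistrC V (x y : V) : rnorm (x - y) = rnorm (y - x).
Proof. by rewrite -rnormN opprB. Qed.

Lemma rnormZ V (a : R[i]) (x : V) :
  rnorm (a *: x) = rnorm (a : R[i]^o) * rnorm x.
Proof. by apply: complexI; rewrite rmorphM/= !rnormE normrZ. Qed.

Lemma rnormM (a b : R[i]) :
  rnorm (a * b : R[i]^o) = rnorm (a : R[i]^o) * rnorm (b : R[i]^o).
Proof. exact: (@rnormZ R[i]^o). Qed.

Lemma rnormC (a : R) : rnorm (a%:C : R[i]^o) = `|a|.
Proof.
by apply: complexI; rewrite rnormE normc_def/= expr0n/= addr0 sqrtr_sqr.
Qed.

Lemma rnormcJ (a : R[i]) : rnorm (Num.conj a : R[i]^o) = rnorm (a : R[i]^o).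
Proof. by apply: complexI; rewrite !rnormE norm_conjC. Qed.

Lemma rnorm_sum V I (s : seq I) (P : pred I) (f : I -> V) :
  rnorm (\sum_(i <- s | P i) f i) <= \sum_(i <- s | P i) rnorm (f i).
Proof.
elim/big_rec2 : _ => [|i a b _ h]; first by rewrite rnorm0.
by rewrite (le_trans (rnormD _ _))// lerD2l.
Qed.

Lemma Re_le_rnorm (a : R[i]) : complex.Re a <= rnorm (a : R[i]^o).
Proof.
rewrite -lecR rnormE normc_def lecR.
rewrite (le_trans (ler_norm _))// -sqrtr_sqr.
by rewrite ler_sqrt ?lerDl ?sqr_ge0 ?addr_ge0 ?sqr_ge0.
Qed.

(** The radii of the metric of V are the positive elements of R[i]; these are real, so real radii
    suffice. *)
Lemma rcvgP V T (F : set_system T) (FF : Filter F) (f : T -> V) (l : V) :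
  f @ F --> l <-> forall e : R, 0 < e -> \forall t \near F, rnorm (l - f t) < e.
Proof.
split=> [/cvgrPdist_lt h e e0|h].
  have /h : 0 < e%:C by rewrite ltcR.
  by apply: filterS => t; rewrite -rnormE ltcR.
apply/cvgrPdist_lt => e e0.
have eE : e = (complex.Re e)%:C by rewrite RRe_real// gtr0_real.
have /h : 0 < complex.Re e by rewrite -ltcR -eE.
by apply: filterS => t; rewrite -ltcR -eE rnormE.
Qed.

Lemma rcvg0P V (x : nat -> V) (l : V) :
  x @ \oo --> l <-> (fun n => rnorm (l - x n)) @ \oo --> (0 : R).
Proof.
rewrite rcvgP; split=> [h|/cvgrPdist_lt h].
  apply/cvgrPdist_lt => e /h; apply: filterS => n.
  by rewrite sub0r normrN ger0_norm ?rnorm_ge0.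
move=> e /h; apply: filterS => n.
by rewrite sub0r normrN ger0_norm ?rnorm_ge0.
Qed.

Lemma rcvg_le V (x : nat -> V) (l : V) (d : nat -> R) :
  (forall n, rnorm (l - x n) <= d n) -> d @ \oo --> (0 : R) -> x @ \oo --> l.
Proof.
move=> le d0; apply/rcvg0P; apply: (squeeze_cvgr _ (cvg_cst 0) d0).
by apply: nearW => n; rewrite rnorm_ge0 le.
Qed.

Lemma cvgn_le_const (u : nat -> R) (l c : R) :
  u @ \oo --> l -> (forall n, u n <= c) -> l <= c.
Proof.
move=> ul uc; rewrite -(cvg_lim (@Rhausdorff _) ul).
by apply: limr_le; [apply/cvg_ex; exists l|exact: nearW].
Qed.

Lemma cvg_harmonic0 : (fun n => n.+1%:R^-1 : R) @ \oo --> (0 : R).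
Proof. exact: cvg_harmonic. Qed.

Lemma rcvg_uniq V (x : nat -> V) (l l' : V) :
  x @ \oo --> l -> x @ \oo --> l' -> l = l'.
Proof. exact: (@cvg_unique _ (@norm_hausdorff _ _)). Qed.

Lemma rcvg_rnorm V (x : nat -> V) (l : V) :
  x @ \oo --> l -> (fun n => rnorm (x n)) @ \oo --> rnorm l.
Proof.
move/rcvgP => h; apply/cvgrPdist_lt => e /h; apply: filterS => n.
apply: le_lt_trans; rewrite ler_norml.
have := rnormD (x n - l) l; have := rnormD (l - x n) (x n).
rewrite !subrK rdistrC => h1 h2; apply/andP; split; lra.
Qed.

Lemma rcvg_rnorm_le V (x : nat -> V) (l : V) (c : R) :
  x @ \oo --> l -> (forall n, rnorm (x n) <= c) -> rnorm l <= c.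
Proof. by move=> /rcvg_rnorm h /(cvgn_le_const h). Qed.

Lemma rcvg_cauchy (V : completeNormedModType R[i]) (x : nat -> V) (e : nat -> R) :
  (forall n k, (n <= k)%N -> rnorm (x k - x n) <= e n) ->
  e @ \oo --> (0 : R) -> cvgn x.
Proof.
move=> xe e0; apply/cauchy_cvgP/cauchyP => d d0.
have dE : d = (complex.Re d)%:C by rewrite RRe_real// gtr0_real.
have rd0 : 0 < complex.Re d by rewrite -ltcR -dE.
move/cvgrPdist_lt : e0 => /(_ _ rd0) [N _ eN].
exists (x N), N => // k /= Nk.
rewrite -ball_normE /= -rnormE dE ltcR rdistrC (le_lt_trans (xe _ _ Nk))//.
have := eN N (leqnn _); rewrite sub0r normrN; exact/le_lt_trans/ler_norm.
Qed.

(** Meant for sums that behave like orthogonal series: the tails [limn u - u n] of the bounded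
    monotone sequence u give the modulus of convergence. *)
Lemma rcvg_sqr_cauchy (V : completeNormedModType R[i]) (x : nat -> V)
    (C D : R) (u : nat -> R) : 0 <= C ->
  (forall n k, (n <= k)%N -> u n <= u k) -> (forall n, u n <= D) ->
  (forall n k, (n <= k)%N -> rnorm (x k - x n) ^+ 2 <= C * (u k - u n)) ->
  cvgn x.
Proof.
move=> C0 nd uD xu.
have ndu : nondecreasing_seq u by move=> n k; exact: nd.
have bu : has_ubound (range u) by exists D => _ [n _ <-].
have cu := nondecreasing_is_cvgn ndu bu.
apply: (@rcvg_cauchy _ _ (fun n => Num.sqrt (C * (limn u - u n)))).
  move=> n k nk.
  have h : rnorm (x k - x n) ^+ 2 <= C * (limn u - u n).
    rewrite (le_trans (xu _ _ nk))// ler_wpM2l// lerB//.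
    exact: nondecreasing_cvgn_le.
  by rewrite -[leLHS]ger0_norm ?rnorm_ge0// -sqrtr_sqr ler_wsqrtr.
have h : (fun n => C * (limn u - u n)) @ \oo --> (0 : R).
  rewrite -(mulr0 C); apply: cvgMl_tmp; rewrite -(subrr (limn u)).
  by apply: cvgB => //; exact: cvg_cst.
by have := cvg_comp _ _ h (@sqrt_continuous R 0); rewrite sqrtr0.
Qed.

End RealNorm.

(** * Hilbert spaces: Riesz' theorem and adjoints *)

Lemma addcJ_Re (R : realType) (a : R[i]) : (complex.Re a)%:C *+ 2 = a + Num.conj a.
Proof.
rewrite mulr2n; case: a => a b; apply/eqP.
by rewrite eq_complex/= addr0 subrr !eqxx.
Qed.

Lemma Re_conj (R : realType) (a : R[i]) : @complex.Re R (Num.conj a) = complex.Re a.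
Proof. by case: a. Qed.

Section Hilbert.
Variables (R : realType) (E : hilbert R).
Implicit Types x y z : E.
Local Notation "''[' x , y ]" := (hdot E x y) : ring_scope.

Lemma hdot_sqr x : '[x, x] = (rnorm x ^+ 2)%:C.
Proof. by rewrite rmorphXn/= rnormE hdot_norm. Qed.

Lemma rnorm_sqrE x : rnorm x ^+ 2 = complex.Re '[x, x].
Proof. by rewrite hdot_sqr. Qed.

Lemma hdotC x y : '[x, y] = Num.conj '[y, x].
Proof. by rewrite hermC/= expr0 mul1r. Qed.

Lemma hdotDl x y z : '[x + y, z] = '[x, z] + '[y, z].
Proof. exact: linearDl. Qed.

Lemma hdotDr x y z : '[z, x + y] = '[z, x] + '[z, y].
Proof. exact: linearDr. Qed.

Lemma hdotBl x y z : '[x - y, z] = '[x, z] - '[y, z].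
Proof. exact: linearBl. Qed.

Lemma hdotBr x y z : '[z, x - y] = '[z, x] - '[z, y].
Proof. exact: linearBr. Qed.

Lemma hdotNr x y : '[x, - y] = - '[x, y].
Proof. exact: linearNr. Qed.

Lemma hdotZl a x y : '[a *: x, y] = a * '[x, y].
Proof. exact: linearZl_LR. Qed.

Lemma hdotZr a x y : '[x, a *: y] = Num.conj a * '[x, y].
Proof. exact: linearZr_LR. Qed.

Lemma hdot0l x : '[0, x] = 0.
Proof. exact: linear0l. Qed.

Lemma hdot0r x : '[x, 0] = 0.
Proof. exact: linear0r. Qed.

Lemma hdot_suml I (s : seq I) (P : pred I) (f : I -> E) x :
  '[\sum_(i <- s | P i) f i, x] = \sum_(i <- s | P i) '[f i, x].
Proof. exact: linear_sumlz. Qed.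

Lemma hdot_sumr I (s : seq I) (P : pred I) (f : I -> E) x :
  '[x, \sum_(i <- s | P i) f i] = \sum_(i <- s | P i) '[x, f i].
Proof. exact: linear_sumr. Qed.

(** Cauchy-Schwarz without division: with b = |y|^2 and a = <x, y>, one has |b x - a y|^2 = b (b
    |x|^2 - |a|^2). *)
Lemma hdot_le x y : rnorm ('[x, y] : R[i]^o) <= rnorm x * rnorm y.
Proof.
have [y0|/negP/negP y0] := eqVneq (rnorm y) 0.
  by rewrite (rnorm_eq0 y0) hdot0r !rnorm0 mulr0.
rewrite -(@ler_pXn2r _ 2) ?nnegrE ?mulr_ge0 ?rnorm_ge0// exprMn.
set b := rnorm y ^+ 2; set a := '[x, y].
have b0 : 0 < b by rewrite exprn_gt0// lt_neqAle eq_sym y0 rnorm_ge0.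
rewrite -(ler_pM2l b0) -subr_ge0 -ler0c.
have aE : a * Num.conj a = (rnorm (a : R[i]^o) ^+ 2)%:C.
  by rewrite rmorphXn/= rnormcE normCK.
suff -> : (b * (rnorm x ^+ 2 * b) - b * rnorm (a : R[i]^o) ^+ 2)%:C =
    '[b%:C *: x - a *: y, b%:C *: x - a *: y] by rewrite hdot_sqr ler0c sqr_ge0.
have bJ : Num.conj b%:C = b%:C by apply/eqP; rewrite eq_complex/= oppr0 !eqxx.
rewrite hdotBl !hdotBr !hdotZl !hdotZr bJ -/a.
have -> : '[y, x] = Num.conj a by rewrite hdotC.
have -> : '[y, y] = b%:C by rewrite hdot_sqr.
rewrite hdot_sqr; move: aE; move: (rnorm _ ^+ 2) (rnorm _ ^+ 2) => X N aE.
rewrite rmorphB !rmorphM/= -aE; ring.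
Qed.

Lemma Re_hdot_le x y : complex.Re '[x, y] <= rnorm x * rnorm y.
Proof. exact: le_trans (Re_le_rnorm _) (hdot_le _ _). Qed.

Lemma hdot_ext x y : (forall z, '[x, z] = '[y, z]) -> x = y.
Proof.
move=> h; apply/subr0_eq/rnorm_eq0/eqP; rewrite -sqrf_eq0.
have := hdot_sqr (x - y); rewrite {1}hdotBl h subrr => /esym/eqP.
by rewrite (inj_eq (@complexI R) _ 0).
Qed.

Lemma hdot_cvgr (x_ : nat -> E) x y :
  x_ @ \oo --> x -> ('[y, x_ n] : R[i]^o) @[n --> \oo] --> ('[y, x] : R[i]^o).
Proof.
move/rcvg0P => h; apply: (@rcvg_le _ _ _ _ (fun n => rnorm y * rnorm (x - x_ n))).
  by move=> n; rewrite -hdotBr hdot_le.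
by rewrite -(mulr0 (rnorm y)); exact: cvgMl_tmp.
Qed.

Lemma Re_hdotC x y : complex.Re '[x, y] = complex.Re '[y, x].
Proof. by rewrite [in LHS]hdotC; exact: Re_conj. Qed.

Lemma rnorm_sqrD x y :
  rnorm (x + y) ^+ 2 = rnorm x ^+ 2 + rnorm y ^+ 2 + complex.Re '[x, y] *+ 2.
Proof.
apply: complexI; rewrite -hdot_sqr hdotDl !hdotDr !rmorphD/= -!hdot_sqr.
by rewrite -[_ + _%:C]mulr2n addcJ_Re -hdotC; ring.
Qed.

End Hilbert.

Section LinearMaps.
Variable R : realType.

Lemma linear_op0 (V W : lmodType R[i]) (A : V -> W) : linear A -> A 0 = 0.
Proof. by move=> lA; have := lA (-1) 0 0; rewrite scaler0 addr0 scaleN1r addNr. Qed.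

Lemma linear_opZ (V W : lmodType R[i]) (A : V -> W) a x :
  linear A -> A (a *: x) = a *: A x.
Proof. by move=> lA; have := lA a x 0; rewrite (linear_op0 lA) !addr0. Qed.

Lemma linear_opD (V W : lmodType R[i]) (A : V -> W) x y :
  linear A -> A (x + y) = A x + A y.
Proof. by move=> lA; have := lA 1 x y; rewrite !scale1r. Qed.

Lemma linear_opB (V W : lmodType R[i]) (A : V -> W) x y :
  linear A -> A (x - y) = A x - A y.
Proof.
move=> lA; rewrite (linear_opD _ _ lA) -[in LHS]scaleN1r.
by rewrite (linear_opZ _ _ lA) scaleN1r.
Qed.

Lemma linear_op_sum (V W : lmodType R[i]) (A : V -> W) I (s : seq I)
    (P : pred I) (f : I -> V) :
  linear A -> A (\sum_(i <- s | P i) f i) = \sum_(i <- s | P i) A (f i).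
Proof.
move=> lA; elim/big_rec2 : _ => [|i y z _ <-]; first exact: linear_op0 lA.
exact: linear_opD lA.
Qed.

Lemma linear_bounded_cvg (V W : normedModType R[i]) (A : V -> W) (M : R) :
  linear A -> (forall x, rnorm (A x) <= M * rnorm x) ->
  forall (x_ : nat -> V) x, x_ @ \oo --> x -> (fun n => A (x_ n)) @ \oo --> A x.
Proof.
move=> lA AM x_ x /rcvg0P h.
apply: (@rcvg_le _ _ _ _ (fun n => M * rnorm (x - x_ n))).
  by move=> n; rewrite -linear_opB.
by rewrite -(mulr0 M); exact: cvgMl_tmp.
Qed.

End LinearMaps.

Section Riesz.
Variables (R : realType) (E : hilbert R).
Implicit Types x y z : E.
Local Notation "''[' x , y ]" := (hdot E x y) : ring_scope.

(* The vector z is the limit of a minimising sequence of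
   x |-> |x|^2 - 2 Re (f x). *)
Lemma riesz (f : E -> R[i]) (M : R) :
  (forall a x y, f (a *: x + y) = a * f x + f y) ->
  (forall x, rnorm (f x : R[i]^o) <= M * rnorm x) ->
  exists z, forall x, f x = '[x, z].
Proof.
move=> fl fM.
have fD x y : f (x + y) = f x + f y by have := fl 1 x y; rewrite scale1r mul1r.
have f0 : f 0 = 0 by have /eqP := fD 0 0; rewrite addr0 -subr_eq subrr => /eqP <-.
have fZ a x : f (a *: x) = a * f x by have := fl a x 0; rewrite f0 !addr0.
pose J x := rnorm x ^+ 2 - complex.Re (f x) *+ 2.
have JD x y : J (x + y) =
    J x + rnorm y ^+ 2 + (complex.Re '[x, y] - complex.Re (f y)) *+ 2.
  by rewrite /J fD rnorm_sqrD raddfD/=; ring.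
have J_ge x : - M ^+ 2 <= J x.
  rewrite /J; have := le_trans (Re_le_rnorm _) (fM x).
  by have := sqr_ge0 (rnorm x - M); rewrite sqrrB; lra.
have Jinf : has_inf (range J).
  by split; [exists (J 0), 0|exists (- M ^+ 2) => _ [x _ <-]].
pose d := inf (range J).
have Jd x : d <= J x by apply: (ge_inf Jinf.2); exists x.
pose e n : R := n.+1%:R^-1.
have e_gt0 n : 0 < e n by rewrite invr_gt0.
have /choice [x_ x_P] : forall n, exists x, J x < d + e n.
  move=> n; have [_ [x _ <-] xe] := inf_adherent (e_gt0 n) Jinf.
  by exists x.
have para x y : J (x + y) + J (x - y) = J x *+ 2 + rnorm y ^+ 2 *+ 2.
  have fN : f (- y) = - f y by rewrite -scaleN1r fZ mulN1r.
  rewrite !JD rnormN hdotNr fN !raddfN/=.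
  by ring.
(* Parallelogram law at the midpoint u and the half difference v: since J u >= d while both values
   of J are below d + e n, at most e n is left for |v|^2. *)
have close n k : (n <= k)%N -> rnorm (x_ k - x_ n) <= 2 * Num.sqrt (e n).
  move=> nk; pose u := 2^-1 *: (x_ k + x_ n); pose v := 2^-1 *: (x_ k - x_ n).
  have half x : 2^-1 *: x + 2^-1 *: x = x :> E.
    by rewrite -scalerDl -[X in X + X]mul1r -splitr scale1r.
  have uv : u + v = x_ k.
    by rewrite /u /v !scalerDr addrACA half scalerN subrr addr0.
  have uv' : u - v = x_ n.
    by rewrite /u /v !scalerDr scalerN opprD opprK addrACA half subrr add0r.
  have h := para u v; rewrite uv uv' in h.
  have vE : rnorm v = 2^-1 * rnorm (x_ k - x_ n).
    rewrite /v rnormZ; congr (_ * _).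
    have -> : 2^-1 = (2^-1 : R)%:C :> R[i] by rewrite fmorphV rmorph_nat.
    by rewrite rnormC ger0_norm.
  have ekn : e k <= e n by rewrite lef_pV2 ?posrE// ler_nat ltnS.
  rewrite -[leLHS]ger0_norm ?rnorm_ge0// -sqrtr_sqr.
  have -> : 2 * Num.sqrt (e n) = Num.sqrt (4 * e n).
    by rewrite sqrtrM// (_ : 4 = 2 ^+ 2 :> R) ?sqrtr_sqr ?ger0_norm// -natrX.
  rewrite ler_wsqrtr//.
  have := Jd u; have := x_P n; have := x_P k.
  move: h; rewrite vE exprMn. lra.
have e0 : e @ \oo --> (0 : R) by exact: cvg_harmonic0.
have se0 : (fun n => 2 * Num.sqrt (e n)) @ \oo --> (0 : R).
  rewrite -[X in _ --> X](mulr0 2); apply: cvgMl_tmp.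
  by have := cvg_comp _ _ e0 (@sqrt_continuous R 0); rewrite sqrtr0.
have /cvg_ex[z xz] := rcvg_cauchy close se0.
(* Minimality passed to the limit, from d <= J (x_ n + y) and J (x_ n) < d + e n. *)
have key y : 0 <= rnorm y ^+ 2 + (complex.Re '[z, y] - complex.Re (f y)) *+ 2.
  apply: (@cvgn_le_const _ (fun n => - e n - rnorm (z - x_ n) * rnorm y *+ 2)).
    rewrite -[X in _ --> X](subr0 0) -[X in _ - X](mul0rn _ 2).
    rewrite -[X in _ - X *+ _](mul0r (rnorm y)).
    apply: cvgB; first by rewrite -[X in _ --> X]oppr0; exact: cvgN.
    by apply: cvgMn; apply: cvgMr_tmp; exact/rcvg0P.
  move=> n; have := JD (x_ n) y; have := Jd (x_ n + y); have := x_P n.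
  have := Re_hdot_le (x_ n - z) y; rewrite hdotBl raddfB/= rdistrC; lra.
exists z => y; apply/eqP; rewrite -subr_eq0; apply/eqP.
move gdef : (f y - '[y, z]) => g.
apply: (@rnorm_eq0 _ (R[i]^o)); apply/eqP; rewrite -sqrf_eq0 eq_le sqr_ge0 andbT.
(* Testing [key] at s conj(g) y gives 0 <= s |g|^2 (s |y|^2 - 2). This s makes s |y|^2 <= 1, which
   forces g = 0. *)
pose s := (rnorm y ^+ 2 + 1)^-1.
have s0 : 0 < s by rewrite invr_gt0 ltr_wpDl ?sqr_ge0.
have := key ((s%:C * Num.conj g) *: y).
have gE : Num.conj g * g = (rnorm (g : R[i]^o) ^+ 2)%:C.
  by rewrite rmorphXn/= rnormcE normCK mulrC.
rewrite rnormZ rnormM rnormcJ rnormC gtr0_norm//.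
rewrite Re_hdotC.
rewrite hdotZl fZ -raddfB/= -mulrBr -(opprB (f y)) gdef mulrN -(mulrA s%:C) gE.
rewrite -rmorphM/= => h.
have hs : s * (rnorm y ^+ 2) <= 1.
  by rewrite mulrC ler_pdivrMr ?mul1r ?lerDl// ltr_wpDl ?sqr_ge0.
have {}h : 0 <= s * (rnorm (g : R[i]^o) ^+ 2 * (s * rnorm y ^+ 2 - 2)).
  by move: h; rewrite !exprMn; lra.
rewrite pmulr_rge0// in h.
have := sqr_ge0 (rnorm (g : R[i]^o)); nra.
Qed.

Lemma bounded_op_ge0 (A : E -> E) : bounded_op A ->
  exists2 M, 0 <= M & forall x, rnorm (A x) <= M * rnorm x.
Proof.
move=> [_ [M AM]]; exists (Num.max 0 M); first by rewrite le_max lexx.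
by move=> x; rewrite (le_trans (AM x))// ler_wpM2r ?rnorm_ge0// le_max lexx orbT.
Qed.

Lemma bounded_op_id : bounded_op (@id E).
Proof. by split => //; exists 1 => x; rewrite mul1r. Qed.

Lemma bounded_op_comp (A B : E -> E) :
  bounded_op A -> bounded_op B -> bounded_op (A \o B).
Proof.
move=> bA bB; have [M M0 AM] := bounded_op_ge0 bA.
have [N N0 BN] := bounded_op_ge0 bB; split.
  by move=> a x y /=; rewrite bB.1 bA.1.
by exists (M * N) => x /=; rewrite -mulrA (le_trans (AM _))// ler_wpM2l.
Qed.

Lemma adjointE (A : E -> E) : bounded_op A ->
  forall x y, '[A x, y] = '[x, adjoint A y].
Proof.
move=> bA; suff : exists B : E -> E, forall x y, '[A x, y] = '[x, B y].
  case=> B AB; pose P B := forall x y, '[A x, y] = '[x, B y].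
  by apply: (@xgetPex _ (fun=> 0) P); exists B.
have [M M0 AM] := bounded_op_ge0 bA.
suff /choice [B AB] : forall y, exists z, forall x, '[A x, y] = '[x, z].
  by exists B => x y.
move=> y; apply: (@riesz _ (M * rnorm y)).
  by move=> a u v; rewrite bA.1 hdotDl hdotZl.
move=> x; rewrite (le_trans (hdot_le _ _))// mulrAC ler_wpM2r ?rnorm_ge0//.
Qed.

Lemma adjointEr (A : E -> E) : bounded_op A ->
  forall x y, '[x, A y] = '[adjoint A x, y].
Proof. by move=> bA x y; rewrite hdotC adjointE// -hdotC. Qed.

Lemma adjoint_unique (A B : E -> E) : bounded_op A ->
  (forall x y, '[A x, y] = '[x, B y]) -> adjoint A = B.
Proof.
move=> bA AB; apply/funext => y; apply: hdot_ext => z.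
by rewrite [LHS]hdotC [RHS]hdotC -adjointE// AB.
Qed.

Lemma adjoint_linear (A : E -> E) : bounded_op A -> linear (adjoint A).
Proof.
move=> bA a x y; apply: hdot_ext => z.
by rewrite hdotDl hdotZl -!adjointEr// hdotDl hdotZl.
Qed.

Lemma adjoint_comp (A B : E -> E) : bounded_op A -> bounded_op B ->
  adjoint (A \o B) = adjoint B \o adjoint A.
Proof.
move=> bA bB; apply: adjoint_unique; first exact: bounded_op_comp.
by move=> x y /=; rewrite !adjointE.
Qed.

Lemma adjoint_id : adjoint (@id E) = id.
Proof. by apply: adjoint_unique => //; exact: bounded_op_id. Qed.

Lemma adjoint_le (A : E -> E) (M : R) : bounded_op A ->
  (forall x, rnorm (A x) <= M * rnorm x) ->
  forall x, rnorm (adjoint A x) <= M * rnorm x.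
Proof.
move=> bA AM x; have [/eqP/rnorm_eq0->|n0] := boolP (rnorm (adjoint A x) == 0).
  by rewrite rnorm0; apply: le_trans (AM x); exact: rnorm_ge0.
have n_gt0 : 0 < rnorm (adjoint A x) by rewrite lt_neqAle eq_sym n0 rnorm_ge0.
rewrite -(ler_pM2r n_gt0) -expr2 -lecR -hdot_sqr -adjointEr//.
rewrite -[leLHS](@RRe_real _) ?lecR; last first.
  by rewrite adjointEr// hdot_sqr; apply/complex_realP; eexists.
rewrite (le_trans (Re_hdot_le _ _))// mulrAC mulrC ler_wpM2r ?rnorm_ge0//.
Qed.

End Riesz.

(** * Finite families of operators and of orthonormal vectors *)

Lemma cauchy_schwarz_sum (R : realDomainType) I (s : seq I) (u v : I -> R) :
  (\sum_(i <- s) u i * v i) ^+ 2 <=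
  (\sum_(i <- s) u i ^+ 2) * (\sum_(i <- s) v i ^+ 2).
Proof.
elim: s => [|i s ih]; first by rewrite !big_nil expr0n mulr0.
rewrite !big_cons; move: ih.
have U0 : 0 <= \sum_(j <- s) u j ^+ 2 by apply: sumr_ge0 => j _; exact: sqr_ge0.
have V0 : 0 <= \sum_(j <- s) v j ^+ 2 by apply: sumr_ge0 => j _; exact: sqr_ge0.
move: (u i) (v i) (\sum_(j <- s) u j * v j) => a b S.
move: (\sum_(j <- s) u j ^+ 2) (\sum_(j <- s) v j ^+ 2) U0 V0 => U V U0 V0 SUV.
(* Only the cross term remains; by the induction hypothesis its square is at most 4 a^2 b^2 U V,
   hence at most (a^2 V + b^2 U)^2. *)
suff : (a * b * S) *+ 2 <= a ^+ 2 * V + b ^+ 2 * U by move: SUV; lra.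
have pos : 0 <= a ^+ 2 * V + b ^+ 2 * U by rewrite addr_ge0// mulr_ge0// sqr_ge0.
rewrite (le_trans (ler_norm _))// -(@ler_pXn2r _ 2) ?nnegrE// real_normK ?num_real//.
have h : (a * b) ^+ 2 * S ^+ 2 <= (a * b) ^+ 2 * (U * V).
  by rewrite ler_wpM2l// sqr_ge0.
have := sqr_ge0 (a ^+ 2 * V - b ^+ 2 * U); move: h; lra.
Qed.

Section FiniteFamilies.
Variables (R : realType) (E : hilbert R).
Local Notation "''[' x , y ]" := (hdot E x y) : ring_scope.

Section Rows.
Variables (I : Type) (A : I -> E -> E) (w : I -> R) (s : seq I) (C : R).
Hypotheses (bA : forall i, bounded_op (A i)) (w_gt0 : forall i, 0 < w i).
Hypothesis C_ge0 : 0 <= C.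
Hypothesis A_le : forall y,
  \sum_(i <- s) w i * rnorm (adjoint (A i) y) ^+ 2 <= C * rnorm y ^+ 2.

(** Duality of rows and columns: for z the sum, |z|^2 is the sum of the Re <h i, adjoint (A i) z>.
    Cauchy-Schwarz, with sqrt (w i) set against its inverse, brings in [A_le] at z, and a factor
    |z|^2 cancels. *)
Lemma rnorm_row_le (h : I -> E) :
  rnorm (\sum_(i <- s) A i (h i)) ^+ 2 <=
  C * \sum_(i <- s) (w i)^-1 * rnorm (h i) ^+ 2.
Proof.
set z := \sum_(i <- s) _; set K := \sum_(i <- s) (w i)^-1 * _.
have K_ge0 : 0 <= K.
  by apply: sumr_ge0 => i _; rewrite mulr_ge0 ?sqr_ge0// invr_ge0 ltW.
have [/eqP z0|z0] := boolP (rnorm z == 0).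
  by rewrite z0 expr0n mulr_ge0.
have z_gt0 : 0 < rnorm z ^+ 2.
  by rewrite exprn_gt0// lt_neqAle eq_sym z0 rnorm_ge0.
rewrite -(ler_pM2r z_gt0) -expr2.
have sw i : Num.sqrt (w i) != 0 by rewrite sqrtr_eq0 -ltNge.
have zE : rnorm z ^+ 2 <= \sum_(i <- s)
    ((Num.sqrt (w i))^-1 * rnorm (h i)) *
    (Num.sqrt (w i) * rnorm (adjoint (A i) z)).
  rewrite rnorm_sqrE {1}/z hdot_suml raddf_sum; apply: ler_sum => i _ /=.
  by rewrite adjointE// mulrACA mulVf// mul1r; exact: Re_hdot_le.
rewrite (le_trans (lerXn2r 2 _ _ zE)) ?nnegrE ?sqr_ge0//.
  apply: sumr_ge0 => i _.
  by rewrite !mulr_ge0 ?invr_ge0 ?sqrtr_ge0 ?rnorm_ge0.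
rewrite (le_trans (cauchy_schwarz_sum _ _ _))// mulrAC [leRHS]mulrC.
under eq_bigr do rewrite exprMn exprVn sqr_sqrtr ?ltW//.
under [X in _ * X]eq_bigr do rewrite exprMn sqr_sqrtr ?ltW//.
by rewrite ler_wpM2l.
Qed.

Definition row_op x := \sum_(i <- s) (w i)%:C *: A i (adjoint (A i) x).

Lemma row_op_dot x :
  complex.Re '[row_op x, x] = \sum_(i <- s) w i * rnorm (adjoint (A i) x) ^+ 2.
Proof.
rewrite hdot_suml raddf_sum; apply: eq_bigr => i _ /=.
by rewrite hdotZl adjointE// hdot_sqr -rmorphM.
Qed.

(** A bound on the form bounds the operator: the row estimate is applied to the vectors w_i A_i^* x,
    whose weighted square sum is the form itself. *)
Lemma row_op_le x : rnorm (row_op x) <= C * rnorm x.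
Proof.
rewrite -(@ler_pXn2r _ 2) ?nnegrE ?mulr_ge0 ?rnorm_ge0//.
have -> : row_op x = \sum_(i <- s) A i ((w i)%:C *: adjoint (A i) x).
  by apply: eq_bigr => i _; rewrite (linear_opZ _ _ (bA i).1).
rewrite (le_trans (rnorm_row_le _))// exprMn [C ^+ 2]expr2 -mulrA.
rewrite ler_wpM2l//; apply: le_trans (A_le x); apply: ler_sum => i _.
by rewrite rnormZ rnormC gtr0_norm// exprMn expr2 !mulrA mulVf ?gt_eqF// mul1r.
Qed.


End Rows.

Section Orthonormal.
Variables (I : eqType) (f : I -> E) (s : seq I).
Hypothesis s_uniq : uniq s.
Hypothesis f_on : {in s &, forall a b, '[f a, f b] = (a == b)%:R}.

Lemma orthonormal_sum_dot (c : I -> R[i]) a :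
  a \in s -> '[\sum_(b <- s) c b *: f b, f a] = c a.
Proof.
move=> sa; rewrite hdot_suml (bigD1_seq a)//= hdotZl f_on// eqxx mulr1.
rewrite big_seq_cond big1 ?addr0// => b /andP[sb ba].
by rewrite hdotZl f_on// (negbTE ba) mulr0.
Qed.

Lemma orthonormal_sum_sqr (c : I -> R[i]) :
  rnorm (\sum_(b <- s) c b *: f b) ^+ 2 =
  \sum_(b <- s) rnorm (c b : R[i]^o) ^+ 2.
Proof.
apply: complexI; rewrite -hdot_sqr hdot_sumr rmorph_sum/= big_seq [RHS]big_seq.
apply: eq_bigr => a sa; rewrite hdotZr orthonormal_sum_dot//.
by rewrite rmorphXn/= rnormcE normCK mulrC.
Qed.

Lemma orthonormal_residual v :
  rnorm (v - \sum_(a <- s) '[v, f a] *: f a) ^+ 2 =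
  rnorm v ^+ 2 - \sum_(a <- s) rnorm ('[v, f a] : R[i]^o) ^+ 2.
Proof.
have := orthonormal_sum_sqr (fun a => '[v, f a]).
set p := \sum_(a <- s) '[v, f a] *: f a => pE.
have vp : complex.Re '[p, v] = rnorm p ^+ 2.
  rewrite pE hdot_suml raddf_sum; apply: eq_bigr => a _ /=.
  rewrite hdotZl [X in _ * X]hdotC -normCK -rnormcE -rmorphXn//.
by rewrite -pE rnorm_sqrD rnormN hdotNr raddfN/= Re_hdotC vp; ring.
Qed.

Lemma bessel v :
  \sum_(a <- s) rnorm ('[v, f a] : R[i]^o) ^+ 2 <= rnorm v ^+ 2.
Proof. by rewrite -subr_ge0 -orthonormal_residual sqr_ge0. Qed.

End Orthonormal.

(** The x j may be dependent, so the number m of vectors is part of the conclusion: the residual r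
    of x k is normalised and appended only when it is nonzero. *)
Lemma gram_schmidt k (x : nat -> E) :
  exists m (f : nat -> E) (t : nat -> nat -> R[i]),
    {in iota 0 m &, forall a b, '[f a, f b] = (a == b)%:R} /\
    forall j, (j < k)%N -> x j = \sum_(l <- iota 0 m) t j l *: f l.
Proof.
elim: k => [|k [m [f [t [fon xf]]]]].
  by exists 0, (fun=> 0), (fun=> fun=> 0); split.
pose p := \sum_(l <- iota 0 m) '[x k, f l] *: f l.
pose r := x k - p.
pose t1 j := if j == k then fun l => '[x k, f l] else t j.
have xf1 j : (j < k.+1)%N -> x j =
    \sum_(l <- iota 0 m) t1 j l *: f l + (if j == k then r else 0).
  rewrite /t1 ltnS; case: eqVneq => [->|jk le_jk]; first by rewrite addrC subrK.
  by rewrite addr0 xf// ltn_neqAle jk.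
have [r0|/eqP r0] := pselect (r = 0).
  exists m, f, t1; split=> // j /xf1 ->.
  by rewrite r0 if_same addr0.
have rf l : l \in iota 0 m -> '[r, f l] = 0.
  by move=> lm; rewrite hdotBl orthonormal_sum_dot// ?iota_uniq// subrr.
have rn0 : rnorm r != 0 by apply: contra_neq r0; exact: rnorm_eq0.
pose f1 l := if l == m then ((rnorm r)^-1)%:C *: r else f l.
pose t2 j l := if l == m then (if j == k then (rnorm r)%:C else 0) else t1 j l.
have Nm l : l \in iota 0 m -> (l == m) = false.
  by rewrite mem_iota/= add0n => lm; rewrite ltn_eqF.
exists m.+1, f1, t2; split; last first.
  move=> j /xf1 ->; rewrite -addn1 iotaD big_cat/= add0n big_seq1; congr (_ + _).
    by rewrite !big_seq; apply: eq_bigr => l /Nm lm; rewrite /f1 /t2 lm.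
  rewrite /f1 /t2 eqxx; case: eqP => _; last by rewrite scale0r.
  by rewrite scalerA -rmorphM/= mulfV// scale1r.
have rJ : Num.conj ((rnorm r)^-1)%:C = ((rnorm r)^-1)%:C :> R[i].
  by apply/eqP; rewrite eq_complex/= oppr0 !eqxx.
have m1 l : l \in iota 0 m.+1 -> l != m -> l \in iota 0 m.
  by rewrite !mem_iota/= !add0n ltnS => lm /negbTE ml; rewrite ltn_neqAle ml.
move=> a b am bm; rewrite /f1.
case: (altP (a =P m)) => [ea|na]; case: (altP (b =P m)) => [eb|nb].
- rewrite ea eb eqxx hdotZl hdotZr rJ hdot_sqr -!rmorphM/= mulrA -expr2.
  by rewrite -exprMn mulVf// expr1n.
- by rewrite ea hdotZl rf ?m1// mulr0 eq_sym (negbTE nb).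
- by rewrite eb hdotZr hdotC rf ?m1// conjC0 mulr0 (negbTE na).
- by rewrite fon ?m1.
Qed.

End FiniteFamilies.

(** * Words and the Fock space *)

Section Words.
Variable n : nat.
Implicit Types a b : seq 'I_n.

(** A list rather than a type of tuples, so that cutting words into prefix and suffix is a
    permutation of lists ([words_add]). *)
Definition words k : seq (seq 'I_n) := [seq val t | t <- enum {: k.-tuple 'I_n}].

Definition words_range p q : seq (seq 'I_n) :=
  flatten [seq words k | k <- index_iota p q].

Lemma mem_words a k : (a \in words k) = (size a == k).
Proof.
apply/mapP/idP => [[t _ ->]|ak]; first by rewrite size_tuple.
by exists (Tuple ak); rewrite ?mem_enum.
Qed.

Lemma words_uniq k : uniq (words k).
Proof. by rewrite map_inj_uniq ?enum_uniq//; exact: val_inj. Qed.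

Lemma big_words (V : nmodType) (f : seq 'I_n -> V) k :
  \sum_(a <- words k) f a = \sum_(t : k.-tuple 'I_n) f t.
Proof. by rewrite big_map big_enum. Qed.

Lemma mem_words_range a p q :
  (a \in words_range p q) = (p <= size a < q)%N.
Proof.
rewrite -mem_index_iota; apply/flatten_mapP/idP => [[k kpq]|h].
  by rewrite mem_words => /eqP ->.
by exists (size a); rewrite ?mem_words.
Qed.

Lemma words_range_uniq p q : uniq (words_range p q).
Proof.
rewrite /words_range; have := iota_uniq p (q - p); rewrite -/(index_iota p q).
elim: (index_iota p q) => //= k s ih /andP[ks /ih us].
rewrite cat_uniq words_uniq us andbT/=; apply/hasPn => a /flatten_mapP[j js].
by rewrite !mem_words => /eqP aj; apply: contra ks => /eqP <-; rewrite aj.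
Qed.

Lemma big_words_range (V : nmodType) (f : seq 'I_n -> V) p q :
  \sum_(a <- words_range p q) f a = \sum_(p <= k < q) \sum_(a <- words k) f a.
Proof. by rewrite big_flatten/= big_map. Qed.

Lemma big_words_range_cat (V : nmodType) (f : seq 'I_n -> V) p q : (p <= q)%N ->
  \sum_(a <- words_range 0 q) f a =
  \sum_(a <- words_range 0 p) f a + \sum_(a <- words_range p q) f a.
Proof. by move=> pq; rewrite !big_words_range -big_cat_nat. Qed.

(** Concatenation is injective here because all the first factors have length k. *)
Lemma words_cat_uniq k (s : seq (seq 'I_n)) : uniq s ->
  uniq [seq a ++ b | a <- words k, b <- s].
Proof.
move=> us; apply: allpairs_uniq => //; first exact: words_uniq.
move=> [a b] [a' b'] /allpairsP[[u v] /= [+ _ [-> ->]]].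
move=> + /allpairsP[[u' v'] /= [+ _ [-> ->]]].
rewrite !mem_words => /eqP su /eqP su' /eqP.
by rewrite eqseq_cat ?su ?su'// => /andP[/eqP -> /eqP ->].
Qed.

Lemma words_add k j :
  perm_eq (words (k + j)) [seq a ++ b | a <- words k, b <- words j].
Proof.
apply: uniq_perm; first exact: words_uniq.
  exact/words_cat_uniq/words_uniq.
move=> a; rewrite mem_words; apply/eqP/allpairsP => [sa|[[u v] /= [+ + ->]]].
  exists (take k a, drop k a); rewrite /= !mem_words cat_take_drop.
  by rewrite size_takel ?size_drop sa ?leq_addr// addKn !eqxx.
by rewrite !mem_words size_cat => /eqP -> /eqP ->.
Qed.

End Words.

(** * Basis expansions and synthesis operators on the Fock space *)

Section Fock.
Variables (R : realType) (n : nat) (F : fockSpace R n).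
Local Notation e := (fvec F).
Local Notation "''[' x , y ]" := (hdot _ x y) : ring_scope.

Lemma fvec_on (s : seq (seq 'I_n)) :
  {in s &, forall a b, '[e a, e b] = (a == b)%:R}.
Proof. by move=> a b _ _; exact: fvec_orthonormal. Qed.

Lemma rnorm_fvec a : rnorm (e a) = 1.
Proof.
apply/eqP; rewrite -(@eqrXn2 _ 2) ?rnorm_ge0//; apply/eqP/complexI.
by rewrite -hdot_sqr fvec_orthonormal eqxx expr1n.
Qed.

Definition fock_trunc N (v : F) : F :=
  \sum_(a <- words_range n 0 N) '[v, e a] *: e a.

Lemma fock_trunc_residual N v : rnorm (v - fock_trunc N v) ^+ 2 =
  rnorm v ^+ 2 - \sum_(a <- words_range n 0 N) rnorm ('[v, e a] : R[i]^o) ^+ 2.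
Proof. by apply: orthonormal_residual; [exact: words_range_uniq|exact: fvec_on]. Qed.

Lemma fock_bessel s v : uniq s ->
  \sum_(a <- s) rnorm ('[v, e a] : R[i]^o) ^+ 2 <= rnorm v ^+ 2.
Proof. by move=> us; apply: bessel => //; exact: fvec_on. Qed.

Lemma fock_trunc_linear N : linear (fock_trunc N).
Proof.
move=> c u v; rewrite /fock_trunc scaler_sumr -big_split/=; apply: eq_bigr => a _.
by rewrite hdotDl hdotZl scalerDl scalerA.
Qed.

Lemma fock_trunc_fvec N a : (size a < N)%N -> fock_trunc N (e a) = e a.
Proof.
move=> aN; rewrite /fock_trunc (bigD1_seq a)/= ?words_range_uniq ?mem_words_range//.
rewrite fvec_orthonormal eqxx scale1r big1 ?addr0// => b ba.
by rewrite fvec_orthonormal eq_sym (negbTE ba) scale0r.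
Qed.

Lemma fock_trunc_span p : lspan (range e) p ->
  \forall N \near \oo, fock_trunc N p = p.
Proof.
move=> [k [c [v [ve ->]]]]; have /choice [a av] : forall j, exists a, e a = v j.
  by move=> j; have [a _ <-] := ve j; exists a.
exists (\max_(j < k) size (a j)).+1 => // N /= kN.
rewrite (linear_op_sum _ _ _ (fock_trunc_linear N)); apply: eq_bigr => j _.
rewrite (linear_opZ _ _ (fock_trunc_linear N)) -av fock_trunc_fvec//.
exact: leq_ltn_trans (leq_bigmax j) kN.
Qed.

(** Some p in the span is close to v and is fixed by all late truncations P; then v - P v = (v - p)
    - P (v - p), of norm at most |v - p|. *)
Lemma fock_trunc_cvg v : (fun N => fock_trunc N v) @ \oo --> v.
Proof.
apply/rcvgP => d d0.
have [p [pv pS]] : exists p, ball v d%:C p /\ lspan (range e) p.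
  have [p [bp pS]] : (ball v d%:C)^° `&` lspan (range e) !=set0.
    apply: (@fvec_total _ _ F); last exact: open_interior.
    by exists v; apply: nbhsx_ballx; rewrite ltcR.
  by exists p; split=> //; exact: interior_subset bp.
have [N _ Np] := fock_trunc_span pS.
exists N => // k Nk; have Pp : fock_trunc k p = p := Np k Nk.
have -> : v - fock_trunc k v = (v - p) - fock_trunc k (v - p).
  by rewrite (linear_opB _ _ (fock_trunc_linear k)) Pp opprB addrA subrK.
apply: le_lt_trans (_ : rnorm (v - p) < d).
  rewrite -(@ler_pXn2r _ 2) ?nnegrE ?rnorm_ge0// fock_trunc_residual.
  by rewrite gerBl sumr_ge0// => a _; exact: sqr_ge0.
by move: pv; rewrite -ball_normE /= -rnormE ltcR.
Qed.

Lemma fock_parseval v :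
  (fun N => \sum_(a <- words_range n 0 N) rnorm ('[v, e a] : R[i]^o) ^+ 2)
    @ \oo --> rnorm v ^+ 2.
Proof.
have h := rcvg_rnorm (@fock_trunc_cvg v).
have -> : (fun N => \sum_(a <- words_range n 0 N) rnorm ('[v, e a] : R[i]^o) ^+ 2) =
    (fun N => rnorm (fock_trunc N v) ^+ 2).
  apply/funext => N; rewrite [RHS]orthonormal_sum_sqr//.
    exact: words_range_uniq.
  exact: fvec_on.
exact: (cvgM h h).
Qed.

Lemma fock_linear_ext (V : normedModType R[i]) (A B : F -> V) (M M' : R) :
  linear A -> (forall x, rnorm (A x) <= M * rnorm x) ->
  linear B -> (forall x, rnorm (B x) <= M' * rnorm x) ->
  (forall a, A (e a) = B (e a)) -> A = B.
Proof.
move=> lA AM lB BM AB; apply/funext => v.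
have cA := linear_bounded_cvg lA AM (@fock_trunc_cvg v).
apply: (rcvg_uniq cA).
have -> : (fun N => A (fock_trunc N v)) = (fun N => B (fock_trunc N v)).
  apply/funext => N; rewrite (linear_op_sum _ _ _ lA) (linear_op_sum _ _ _ lB).
  by apply: eq_bigr => a _; rewrite (linear_opZ _ _ lA) (linear_opZ _ _ lB) AB.
exact: linear_bounded_cvg lB BM _ _ (@fock_trunc_cvg v).
Qed.

(* The hypothesis says that g is a Bessel sequence; L is its synthesis operator. *)
Lemma fock_synthesis (V : hilbert R) (g : seq 'I_n -> V) (C : R) : 0 <= C ->
  (forall p q (c : seq 'I_n -> R[i]),
    rnorm (\sum_(a <- words_range n p q) c a *: g a) ^+ 2 <=
    C * \sum_(a <- words_range n p q) rnorm (c a : R[i]^o) ^+ 2) ->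
  exists L : F -> V, [/\ linear L,
    forall v, rnorm (L v) <= Num.sqrt C * rnorm v,
    forall a, L (e a) = g a &
    forall v, (fun N => \sum_(a <- words_range n 0 N) '[v, e a] *: g a)
      @ \oo --> L v].
Proof.
move=> C0 gC.
pose L_ N v := \sum_(a <- words_range n 0 N) '[v, e a] *: g a.
have L_lin N : linear (L_ N).
  move=> c u v; rewrite /L_ scaler_sumr -big_split/=; apply: eq_bigr => a _.
  by rewrite hdotDl hdotZl scalerDl scalerA.
pose u v N := \sum_(a <- words_range n 0 N) rnorm ('[v, e a] : R[i]^o) ^+ 2.
have /choice [L LP] : forall v, exists l : V, (fun N => L_ N v) @ \oo --> l.
  move=> v; apply/cvg_ex; apply: (@rcvg_sqr_cauchy _ _ _ C (rnorm v ^+ 2) (u v)) => //.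
  - move=> p q pq; rewrite /u (big_words_range_cat _ pq) lerDl sumr_ge0// => a _.
    exact: sqr_ge0.
  - by move=> p; apply: fock_bessel; exact: words_range_uniq.
  - move=> p q pq; rewrite /u /L_ !(big_words_range_cat _ pq).
    by rewrite [X in rnorm X]addrAC subrr add0r [X in _ * X]addrAC subrr add0r gC.
exists L; split=> //.
- move=> c x y; apply: (rcvg_uniq (LP _)).
  under eq_fun do rewrite L_lin.
  by apply: cvgD; [apply: cvgZl_tmp|]; exact: LP.
- move=> v; apply: (rcvg_rnorm_le (LP v)) => N.
  rewrite -(@ler_pXn2r _ 2) ?nnegrE ?mulr_ge0 ?rnorm_ge0 ?sqrtr_ge0//.
  rewrite exprMn sqr_sqrtr// (le_trans (gC _ _ _))// ler_wpM2l//.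
  by apply: fock_bessel; exact: words_range_uniq.
- move=> a; apply: (rcvg_uniq (LP _)); apply: cvg_near_cst.
  exists (size a).+1 => // N /= aN; rewrite /L_.
  rewrite (bigD1_seq a)/= ?words_range_uniq ?mem_words_range//.
  rewrite fvec_orthonormal eqxx scale1r big1 ?addr0// => b ba.
  by rewrite fvec_orthonormal eq_sym (negbTE ba) scale0r.
Qed.

End Fock.

(** * Operator norms and row norms of tuples *)

Section OperatorNorm.
Variables (R : realType) (E : hilbert R).
Implicit Types A : E -> E.

Lemma opnormP A : bounded_op A -> exists b : R, [/\ opnorm A = b%:E, 0 <= b,
  forall x, rnorm (A x) <= b * rnorm x &
  forall C, 0 <= C -> (forall x, rnorm (A x) <= C * rnorm x) -> b <= C].
Proof.
move=> bA.
have le_C C : 0 <= C -> (forall x, rnorm (A x) <= C * rnorm x) ->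
    (opnorm A <= C%:E)%E.
  move=> C0 AC; apply: ge_ereal_sup => _ [x /= x1 <-]; rewrite lee_fin.
  by rewrite (le_trans (AC x))// ler_piMr.
have ge0 : (0 <= opnorm A)%E.
  apply: le_ereal_sup_tmp => /=; exists (rnorm (A 0))%:E; last first.
    by rewrite lee_fin rnorm_ge0.
  by exists 0 => //=; rewrite rnorm0.
have [M M0 AM] := bounded_op_ge0 bA.
have fin : opnorm A \is a fin_num.
  by rewrite ge0_fin_numE// (le_lt_trans (le_C _ M0 AM))// ltry.
exists (fine (opnorm A)); rewrite fineK//; split=> //.
- exact: fine_ge0.
- move=> x; have [/eqP/rnorm_eq0->|x0] := boolP (rnorm x == 0).
    by rewrite (linear_op0 bA.1) !rnorm0 mulr0.
  have x_gt0 : 0 < rnorm x by rewrite lt_neqAle eq_sym x0 rnorm_ge0.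
  rewrite -ler_pdivrMr// -lee_fin fineK//; apply: ereal_sup_ubound.
  exists (((rnorm x)^-1)%:C *: x) => /=.
    by rewrite rnormZ rnormC ger0_norm ?invr_ge0 ?rnorm_ge0// mulVf.
  rewrite (linear_opZ _ _ bA.1) rnormZ rnormC ger0_norm ?invr_ge0 ?rnorm_ge0//.
  by rewrite mulrC.
- by move=> C C0 /(le_C _ C0); rewrite -{1}(fineK fin) lee_fin.
Qed.

(** A crude bound, one operator at a time, which only serves to know that [row_op] is bounded. *)
Lemma row_bound (I : Type) (A : I -> E -> E) (w : I -> R) (s : seq I) :
  (forall i, bounded_op (A i)) -> (forall i, 0 <= w i) ->
  exists2 C, 0 <= C & forall y,
    \sum_(i <- s) w i * rnorm (adjoint (A i) y) ^+ 2 <= C * rnorm y ^+ 2.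
Proof.
move=> bA w0.
have /choice [M MP] : forall i, exists M, 0 <= M /\
    forall y, rnorm (adjoint (A i) y) <= M * rnorm y.
  move=> i; have [M M0 AM] := bounded_op_ge0 (bA i).
  by exists M; split=> //; exact: adjoint_le.
exists (\sum_(i <- s) w i * M i ^+ 2).
  by apply: sumr_ge0 => i _; rewrite mulr_ge0// sqr_ge0.
move=> y; rewrite mulr_suml; apply: ler_sum => i _; rewrite -mulrA ler_wpM2l//.
by rewrite -exprMn lerXn2r ?nnegrE ?rnorm_ge0 ?mulr_ge0 ?rnorm_ge0 ?(MP i).1 ?(MP i).2.
Qed.

Lemma row_op_bounded (I : Type) (A : I -> E -> E) (w : I -> R) (s : seq I) :
  (forall i, bounded_op (A i)) -> (forall i, 0 < w i) ->
  bounded_op (row_op A w s).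
Proof.
move=> bA w0; have [C C0 AC] := row_bound s bA (fun i => ltW (w0 i)).
split; last by exists C; exact: row_op_le.
move=> c x y; rewrite /row_op scaler_sumr -big_split; apply: eq_bigr => i _ /=.
rewrite (adjoint_linear (bA i)) (bA i).1 scalerDr !scalerA.
by rewrite [_%:C * c]mulrC.
Qed.

End OperatorNorm.

(** * Row norms of a tuple and their submultiplicativity *)

Section Tuples.
Variables (R : realType) (n : nat) (E : hilbert R) (T : 'I_n -> E -> E).
Hypothesis T_bounded : forall i, bounded_op (T i).

Lemma opword_bounded a : bounded_op (opword T a).
Proof.
by elim: a => [|i a ih]; [exact: bounded_op_id|exact: bounded_op_comp].
Qed.

Lemma opword_cat a b x : opword T (a ++ b) x = opword T a (opword T b x).
Proof. by elim: a => //= i a ->. Qed.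

Lemma opseriesE c N x :
  opseries T c N x = \sum_(a <- words_range n 0 N.+1) c a *: opword T a x.
Proof.
rewrite /opseries fct_sumE big_words_range big_mkord; apply: eq_bigr => k _.
by rewrite fct_sumE big_words.
Qed.

Lemma row_squareE (w : seq 'I_n -> R) k :
  row_square T (fun a => (w a)%:C) k = row_op (opword T) w (words n k).
Proof. by apply/funext => x; rewrite /row_square fct_sumE /row_op big_words. Qed.

(** The quadratic form of the sum of the T_a T_a^* over |a| = k. On forms, submultiplicativity is a
    reindexing of words by their prefixes. *)
Definition row_form k x : R :=
  \sum_(a <- words n k) rnorm (adjoint (opword T a) x) ^+ 2.

Lemma row_form0 x : row_form 0 x = rnorm x ^+ 2.
Proof.
rewrite /row_form (perm_big [:: [::]]) ?big_seq1 /= ?adjoint_id//.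
apply: uniq_perm => //; first exact: words_uniq.
by move=> a; rewrite mem_words inE size_eq0.
Qed.

Lemma row_formD k j x : row_form (k + j) x =
  \sum_(a <- words n k) row_form j (adjoint (opword T a) x).
Proof.
rewrite /row_form (perm_big _ (words_add n k j)) big_allpairs_dep.
apply: eq_bigr => a _; apply: eq_bigr => b _.
have -> : opword T (a ++ b) = opword T a \o opword T b.
  by apply/funext => y; rewrite opword_cat.
by rewrite adjoint_comp//; exact: opword_bounded.
Qed.

(* The square of the norm of the row operator (T_a), |a| = k. *)
Definition row_norm k : R := fine (opnorm (row_square T (fun=> 1) k)).

(** The norm of the row square is the best constant for its form: Cauchy-Schwarz gives one half of
    this, [row_op_le] the other. *)
Lemma row_normP k : [/\ opnorm (row_square T (fun=> 1) k) = (row_norm k)%:E,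
  0 <= row_norm k, forall x, row_form k x <= row_norm k * rnorm x ^+ 2 &
  forall C, 0 <= C -> (forall x, row_form k x <= C * rnorm x ^+ 2) ->
    row_norm k <= C].
Proof.
have rE : row_square T (fun=> 1) k = row_op (opword T) (fun=> 1) (words n k).
  exact: (row_squareE (fun=> 1)).
have fE x : row_form k x =
    \sum_(a <- words n k) 1 * rnorm (adjoint (opword T a) x) ^+ 2.
  by apply: eq_bigr => a _; rewrite mul1r.
have := opnormP (row_op_bounded (words n k) opword_bounded (fun=> ltr01)).
rewrite /row_norm rE => -[b [-> b0 bP bmin]]; split=> //= [x|C C0 fC].
  rewrite fE -row_op_dot; last exact: opword_bounded.
  rewrite (le_trans (Re_hdot_le _ _))// expr2 mulrA ler_wpM2r ?rnorm_ge0//.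
apply: bmin => // x; apply: row_op_le => //; first exact: opword_bounded.
by move=> y; rewrite -fE.
Qed.

Lemma row_norm_ge0 k : 0 <= row_norm k.
Proof. by have [] := row_normP k. Qed.

Lemma row_form_le k x : row_form k x <= row_norm k * rnorm x ^+ 2.
Proof. by have [_ _ h _] := row_normP k; exact: h. Qed.

Lemma row_norm_le k C : 0 <= C ->
  (forall x, row_form k x <= C * rnorm x ^+ 2) -> row_norm k <= C.
Proof. by have [_ _ _ h] := row_normP k; exact: h. Qed.

Lemma row_norm0_le1 : row_norm 0 <= 1.
Proof. by apply: row_norm_le => // x; rewrite row_form0 mul1r. Qed.

Lemma row_normD k j : row_norm (k + j) <= row_norm k * row_norm j.
Proof.
apply: row_norm_le => [|x]; first by rewrite mulr_ge0 ?row_norm_ge0.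
rewrite row_formD mulrAC.
apply: (@le_trans _ _ (\sum_(a <- words n k) row_norm j *
    rnorm (adjoint (opword T a) x) ^+ 2)).
  by apply: ler_sum => a _; exact: row_form_le.
by rewrite -mulr_sumr mulrC ler_wpM2r ?row_norm_ge0 ?row_form_le.
Qed.

Lemma row_norm_eq0 k : (forall a, size a = k -> opword T a = (fun=> 0)) ->
  row_norm k = 0.
Proof.
move=> T0; apply/le_anti; rewrite row_norm_ge0 andbT.
apply: row_norm_le => // x; rewrite mul0r /row_form big_seq big1// => a.
rewrite mem_words => /eqP /T0 a0.
have -> : adjoint (opword T a) x = 0.
  apply: hdot_ext => z; rewrite -adjointEr; last exact: opword_bounded.
  by rewrite a0 hdot0r hdot0l.
by rewrite rnorm0 expr0n.
Qed.

End Tuples.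

Lemma cvg_finite_sum (K : numFieldType) (V : normedModType K) I (s : seq I)
    (f : I -> nat -> V) (l : I -> V) : (forall i, f i @ \oo --> l i) ->
  (fun N => \sum_(i <- s) f i N) @ \oo --> \sum_(i <- s) l i.
Proof.
move=> fl; elim: s => [|i s ih].
  by under eq_fun do rewrite big_nil; rewrite big_nil; exact: cvg_cst.
by under eq_fun do rewrite big_cons; rewrite big_cons; exact: cvgD.
Qed.

(** Follows from the scalar Cesaro theorem applied to the errors |l - x k|. *)
Lemma cvg_vector_mean (R : realType) (V : normedModType R[i]) (x : nat -> V) (l : V) :
  x @ \oo --> l ->
  (fun N => (N.+1%:R^-1)%:C *: \sum_(k < N.+1) x k) @ \oo --> l.
Proof.
move=> /rcvg0P/cesaro h; apply: (rcvg_le _ h) => N.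
have N0 : N.+1%:R != 0 :> R by rewrite pnatr_eq0.
have lE : l = (N.+1%:R^-1)%:C *: \sum_(k < N.+1) l.
  rewrite sumr_const card_ord -[l *+ _]scaler_nat scalerA -(rmorph_nat (real_complex R)).
  by rewrite -rmorphM/= mulVf// scale1r.
rewrite {1}lE -scalerBr -sumrB rnormZ rnormC ger0_norm ?invr_ge0//.
rewrite /arithmetic_mean ler_wpM2l ?invr_ge0// /series/= big_mkord.
exact: rnorm_sum.
Qed.

(** * The functional calculus on the Fock space *)

Section Calculus.
Variables (R : realType) (n : nat) (F : fockSpace R n) (H : hilbert R).
Variables (T : 'I_n -> H -> H) (m : nat -> R).
Hypotheses (T_bounded : forall i, bounded_op (T i)) (m_gt0 : forall k, 0 < m k).
Local Notation e := (fvec F).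
Local Notation "''[' x , y ]" := (hdot _ x y) : ring_scope.
Implicit Types (a b : seq 'I_n) (h : H) (v : F).

(** Every block of the row of operators T_a / m |a| has norm at most sqrt C. Arbitrary blocks, and
    not only initial ones, are what the Cauchy criteria ask for. *)
Definition weighted_row_le (C : R) := forall p q y,
  \sum_(a <- words_range n p q)
     (m (size a) ^- 2) * rnorm (adjoint (opword T a) y) ^+ 2
    <= C * rnorm y ^+ 2.

Let w_gt0 a : 0 < m (size a) ^- 2. Proof. by rewrite invr_gt0 exprn_gt0. Qed.

Let Tw_bounded a : bounded_op (opword T a). Proof. exact: opword_bounded. Qed.

(** The row estimate with weights m^-2 at the vectors y a / m |a|, where the weights cancel. *)
Lemma weighted_sum_le (C : R) : 0 <= C -> weighted_row_le C ->
  forall p q (y : seq 'I_n -> H),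
  rnorm (\sum_(a <- words_range n p q) ((m (size a))^-1)%:C *: opword T a (y a)) ^+ 2
    <= C * \sum_(a <- words_range n p q) rnorm (y a) ^+ 2.
Proof.
move=> C0 HC p q y.
have := @rnorm_row_le _ _ _ (opword T) (fun a => m (size a) ^- 2)
  (words_range n p q) C Tw_bounded w_gt0 C0 (HC p q)
  (fun a => ((m (size a))^-1)%:C *: y a).
under eq_bigr do rewrite (linear_opZ _ _ (Tw_bounded _).1).
under [in leRHS]eq_bigr => a _.
  rewrite rnormZ rnormC gtr0_norm ?invr_gt0// exprMn invrK exprVn mulrA.
  by rewrite mulfV ?mul1r; [over|rewrite expf_neq0 ?gt_eqF].
by [].
Qed.

(** calc h is the synthesis operator of the family T_a h / m |a|, which is a Bessel sequence with
    constant C |h|^2. *)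
Lemma calculus_exists (C : R) : 0 <= C -> weighted_row_le C ->
  exists calc : H -> F -> H, [/\ forall h, linear (calc h),
    forall h v, rnorm (calc h v) <= Num.sqrt C * rnorm h * rnorm v,
    forall h a, calc h (e a) = ((m (size a))^-1)%:C *: opword T a h &
    forall h v, (fun N => \sum_(a <- words_range n 0 N)
      '[v, e a] *: (((m (size a))^-1)%:C *: opword T a h)) @ \oo --> calc h v].
Proof.
move=> C0 HC.
suff /choice [calc cP] : forall h, exists L : F -> H, [/\ linear L,
    forall v, rnorm (L v) <= Num.sqrt C * rnorm h * rnorm v,
    forall a, L (e a) = ((m (size a))^-1)%:C *: opword T a h &
    forall v, (fun N => \sum_(a <- words_range n 0 N)
      '[v, e a] *: (((m (size a))^-1)%:C *: opword T a h)) @ \oo --> L v].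
  by exists calc; split=> h; have [] := cP h.
move=> h.
have [] := @fock_synthesis _ _ F H (fun a => ((m (size a))^-1)%:C *: opword T a h)
  (C * rnorm h ^+ 2).
- by rewrite mulr_ge0 ?sqr_ge0.
- move=> p q c; have := weighted_sum_le C0 HC p q (fun a => c a *: h).
  under eq_bigr do rewrite (linear_opZ _ _ (Tw_bounded _).1) scalerA mulrC -scalerA.
  under [in leRHS]eq_bigr do rewrite rnormZ exprMn.
  by rewrite -mulr_suml [X in _ * X]mulrC mulrA.
move=> L [lL LC Le Lc]; exists L; split=> //.
by move: LC; rewrite sqrtrM// sqrtr_sqr ger0_norm ?rnorm_ge0.
Qed.

Lemma weighted_sum_row_form p q y :
  \sum_(a <- words_range n p q)
     (m (size a) ^- 2) * rnorm (adjoint (opword T a) y) ^+ 2 =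
  \sum_(p <= k < q) (m k ^- 2) * row_form T k y.
Proof.
rewrite big_words_range; apply: eq_bigr => k _; rewrite /row_form mulr_sumr.
by rewrite big_seq [RHS]big_seq; apply: eq_bigr => a; rewrite mem_words => /eqP ->.
Qed.

(** The majorant s is left general so that 1 / (k + 1)^2 can be cut off for nilpotent tuples. *)
Lemma weighted_row_le_series (s : nat -> R) (C : R) : (forall k, 0 <= s k) ->
  (forall k, row_norm T k <= s k * m k ^+ 2) ->
  (forall N, \sum_(0 <= k < N) s k <= C) -> weighted_row_le C.
Proof.
move=> s0 ms sC p q y; rewrite weighted_sum_row_form.
apply: (@le_trans _ _ (\sum_(p <= k < q) s k * rnorm y ^+ 2)).
  apply: ler_sum => k _; rewrite mulrC ler_pdivrMr ?exprn_gt0//.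
  rewrite (le_trans (row_form_le T_bounded _ _))// mulrAC.
  by rewrite ler_wpM2r ?sqr_ge0.
rewrite -mulr_suml ler_wpM2r ?sqr_ge0// (le_trans _ (sC q))//.
have [pq|/ltnW qp] := leqP p q.
  by rewrite (big_cat_nat (leq0n p) pq)/= lerDr sumr_ge0.
by rewrite big_geq// sumr_ge0.
Qed.

Definition weighted_row N x : H :=
  row_op (opword T) (fun a => m (size a) ^- 2) (words_range n 0 N) x.

(** An increment is a row applied to its own adjoint column, so its squared norm is at most C times
    the increment of the form, which is monotone and bounded in N. *)
Lemma weighted_row_sum_exists (C : R) : 0 <= C -> weighted_row_le C ->
  exists S : H -> H, bounded_op S /\
    forall x, (fun N => weighted_row N x) @ \oo --> S x.
Proof.
move=> C0 HC.
suff /choice [S SP] : forall x, exists l : H, (fun N => weighted_row N x) @ \oo --> l.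
  exists S; split=> //; split; last first.
    exists C => x; apply: (rcvg_rnorm_le (SP x)) => N.
    by apply: row_op_le => // y; exact: HC.
  move=> c x y; apply: (rcvg_uniq (SP _)).
  have -> : (fun N => weighted_row N (c *: x + y)) =
      (fun N => c *: weighted_row N x + weighted_row N y).
    apply/funext => N.
    exact: (row_op_bounded (words_range n 0 N) Tw_bounded w_gt0).1.
  by apply: cvgD; [apply: cvgZl_tmp|]; exact: SP.
move=> x; apply/cvg_ex.
pose u N := \sum_(a <- words_range n 0 N)
  (m (size a) ^- 2) * rnorm (adjoint (opword T a) x) ^+ 2.
apply: (@rcvg_sqr_cauchy _ _ _ C (C * rnorm x ^+ 2) u) => //.
- move=> p q pq; rewrite /u (big_words_range_cat _ pq) lerDl sumr_ge0// => a _.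
  by rewrite mulr_ge0 ?sqr_ge0 ?ltW.
- by move=> p; exact: HC.
move=> p q pq; rewrite /u /weighted_row /row_op !(big_words_range_cat _ pq).
rewrite [X in rnorm X]addrAC subrr add0r [X in _ * X]addrAC subrr add0r.
have := weighted_sum_le C0 HC p q
  (fun a => ((m (size a))^-1)%:C *: adjoint (opword T a) x).
under eq_bigr do rewrite (linear_opZ _ _ (Tw_bounded _).1) scalerA -rmorphM -invfM -expr2.
under [in leRHS]eq_bigr do
  rewrite rnormZ rnormC gtr0_norm ?invr_gt0// exprMn exprVn.
by [].
Qed.

(** A block of nonnegative terms is below any longer initial sum, itself below |[weighted_row N y]|
    |y| by Cauchy-Schwarz; then N tends to infinity. *)
Lemma weighted_row_le_opnorm (S : H -> H) (b : R) :
  (forall x, (fun N => weighted_row N x) @ \oo --> S x) ->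
  (forall x, rnorm (S x) <= b * rnorm x) -> weighted_row_le b.
Proof.
move=> Scvg Sb p q y.
apply: (@le_trans _ _ (rnorm (S y) * rnorm y)); last first.
  by rewrite expr2 mulrA ler_wpM2r ?rnorm_ge0.
have h : (fun N => rnorm (weighted_row N y) * rnorm y) @ \oo --> rnorm (S y) * rnorm y.
  by apply: cvgMr_tmp; exact: rcvg_rnorm.
rewrite -(cvg_lim (@Rhausdorff R) h); apply: limr_ge.
  by apply/cvg_ex; exists (rnorm (S y) * rnorm y).
exists q => // N /= qN; rewrite (le_trans _ (Re_hdot_le _ _))// row_op_dot//.
have nn s : 0 <= \sum_(a <- s)
    (m (size a) ^- 2) * rnorm (adjoint (opword T a) y) ^+ 2.
  by apply: sumr_ge0 => a _; rewrite mulr_ge0 ?sqr_ge0 ?ltW.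
have [pq|/ltnW qp] := leqP p q; last first.
  by rewrite weighted_sum_row_form big_geq.
rewrite (big_words_range_cat _ qN) (big_words_range_cat _ pq).
by rewrite -addrA addrCA lerDl addr_ge0.
Qed.

Variable calc : H -> F -> H.
Variable M : R.
Hypothesis calc_linear : forall h, linear (calc h).
Hypothesis calc_le : forall h v, rnorm (calc h v) <= M * rnorm h * rnorm v.
Hypothesis calc_fvec : forall h a,
  calc h (e a) = ((m (size a))^-1)%:C *: opword T a h.
Hypothesis calc_cvg : forall h v, (fun N => \sum_(a <- words_range n 0 N)
  '[v, e a] *: (((m (size a))^-1)%:C *: opword T a h)) @ \oo --> calc h v.

(** [calc] is chosen separately for each h, so linearity in h is read off the limit [calc_cvg]. *)
Lemma calc_linearl v : linear (calc^~ v).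
Proof.
move=> c x y; apply: (rcvg_uniq (@calc_cvg _ v)).
under eq_fun do under eq_bigr do
  rewrite (Tw_bounded _).1 !scalerDr !scalerA [_ * c]mulrC -!scalerA.
under eq_fun do rewrite big_split/= -scaler_sumr.
by apply: cvgD; [apply: cvgZl_tmp|]; exact: calc_cvg.
Qed.

Lemma calc_contr h (v_ : nat -> F) v :
  v_ @ \oo --> v -> (fun N => calc h (v_ N)) @ \oo --> calc h v.
Proof. exact: linear_bounded_cvg. Qed.

(** The bound on u makes the representing vectors summable when infinitely many of them are added
    for w*-continuity. *)
Lemma calc_riesz h y : exists u : F,
  (forall v, '[calc h v, y] = '[v, u]) /\ rnorm u <= M * rnorm h * rnorm y.
Proof.
have le v : rnorm ('[calc h v, y] : R[i]^o) <= M * rnorm h * rnorm y * rnorm v.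
  by rewrite (le_trans (hdot_le _ _))// [leRHS]mulrAC ler_wpM2r ?rnorm_ge0.
have [] := @riesz _ F (fun v => '[calc h v, y]) _ _ le.
  by move=> c u v; rewrite calc_linear hdotDl hdotZl.
move=> u uP; exists u; split=> //; have [/eqP u0|u0] := boolP (rnorm u == 0).
  by rewrite u0; have := le (e [::]); rewrite rnorm_fvec mulr1; exact/le_trans/rnorm_ge0.
have u_gt0 : 0 < rnorm u by rewrite lt_neqAle eq_sym u0 rnorm_ge0.
rewrite -(ler_pM2r u_gt0) -expr2 (le_trans _ (le u))//.
by rewrite uP hdot_sqr rnormC ler_norm.
Qed.

Section MatrixNorm.
Variables (k : nat) (A : 'M[F -> F]_k).
Hypothesis A_linear : forall i j, linear (A i j).
Hypothesis A_le1 : (mxopnorm A <= 1)%E.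

(** Homogeneity: z is rescaled to the unit ball by 1 / sqrt s, the case s = 0 being separate. *)
Lemma mxopnorm_le1 (z : 'I_k -> F) :
  \sum_(i < k) rnorm (\sum_(j < k) A i j (z j)) ^+ 2 <= \sum_(j < k) rnorm (z j) ^+ 2.
Proof.
set s := \sum_(j < k) rnorm (z j) ^+ 2.
have s0 : 0 <= s by apply: sumr_ge0 => j _; exact: sqr_ge0.
have [/eqP|s_neq0] := boolP (s == 0).
  move/eqP; rewrite psumr_eq0 => [/allP z0|j _]; last exact: sqr_ge0.
  apply: (le_trans _ s0); rewrite big1// => i _.
  rewrite big1 ?rnorm0 ?expr0n// => j _.
  have := z0 j (mem_index_enum j); rewrite sqrf_eq0 => /eqP/rnorm_eq0 ->.
  exact: linear_op0 (A_linear i j).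
have s_gt0 : 0 < s by rewrite lt_neqAle eq_sym s_neq0.
pose c := (Num.sqrt s)^-1.
have c2 : c ^+ 2 = s^-1 by rewrite exprVn sqr_sqrtr.
have c_ge0 : 0 <= c by rewrite invr_ge0 sqrtr_ge0.
have : ((Num.sqrt (\sum_(i < k) rnorm (\sum_(j < k) A i j (c%:C *: z j)) ^+ 2))%:E
    <= 1)%E.
  apply: le_trans A_le1; apply: ereal_sup_ubound; exists (fun j => c%:C *: z j) => //=.
  under eq_bigr do rewrite rnormZ rnormC exprMn (ger0_norm c_ge0) c2.
  by rewrite -mulr_sumr mulVf.
under eq_bigr => i _.
  under eq_bigr do rewrite (linear_opZ _ _ (A_linear _ _)).
  rewrite -scaler_sumr rnormZ rnormC exprMn (ger0_norm c_ge0) c2.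
  over.
rewrite -mulr_sumr lee_fin -{1}sqrtr1 ler_sqrt// mulrC ler_pdivrMr// mul1r.
by [].
Qed.

(* Expanding the x j in an orthonormal basis f l turns the coefficient vectors
   into those of A applied to the columns z j = t j l *: e_0, for each l. *)
Lemma calc_matrix_le (C : R) (x : 'I_k -> H) : 0 <= C -> weighted_row_le C ->
  \sum_(j < k) rnorm (x j) ^+ 2 <= 1 ->
  \sum_(i < k) rnorm (\sum_(j < k) calc (x j) (A i j (e [::]))) ^+ 2 <= C.
Proof.
move=> C0 HC x1; pose v i j := A i j (e [::]).
pose Y i N := \sum_(a <- words_range n 0 N)
  ((m (size a))^-1)%:C *: opword T a (\sum_(j < k) '[v i j, e a] *: x j).
have Ycvg i : Y i @ \oo --> \sum_(j < k) calc (x j) (v i j).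
  have -> : Y i = fun N => \sum_(j < k) \sum_(a <- words_range n 0 N)
      '[v i j, e a] *: (((m (size a))^-1)%:C *: opword T a (x j)).
    apply/funext => N; rewrite exchange_big; apply: eq_bigr => a _ /=.
    rewrite (linear_op_sum _ _ _ (Tw_bounded a).1) scaler_sumr.
    apply: eq_bigr => j _; rewrite (linear_opZ _ _ (Tw_bounded a).1) !scalerA.
    by rewrite mulrC.
  by apply: cvg_finite_sum => j; exact: calc_cvg.
suff YC N : \sum_(i < k) rnorm (Y i N) ^+ 2 <= C.
  apply: (cvgn_le_const _ YC); apply: cvg_finite_sum => i.
  by have h := rcvg_rnorm (Ycvg i); exact: (cvgM h h).
(* [gram_schmidt] takes a family over nat, so x is extended by 0. *)
have [d [f [t [fon xf]]]] := gram_schmidt k (fun j => oapp x 0 (insub j)).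
have {}xf (j : 'I_k) : x j = \sum_(l <- iota 0 d) t j l *: f l.
  by rewrite -xf// valK.
have xn (j : 'I_k) : rnorm (x j) ^+ 2 =
    \sum_(l <- iota 0 d) rnorm (t j l : R[i]^o) ^+ 2.
  by rewrite xf orthonormal_sum_sqr// iota_uniq.
have vx i a : rnorm (\sum_(j < k) '[v i j, e a] *: x j) ^+ 2 =
    \sum_(l <- iota 0 d)
      rnorm ('[\sum_(j < k) A i j (t j l *: e [::]), e a] : R[i]^o) ^+ 2.
  rewrite -(orthonormal_sum_sqr (f := f))// ?iota_uniq//; congr (rnorm _ ^+ 2).
  under eq_bigr do rewrite xf scaler_sumr.
  rewrite exchange_big; apply: eq_bigr => l _ /=.
  rewrite hdot_suml scaler_suml; apply: eq_bigr => j _.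
  by rewrite (linear_opZ _ _ (A_linear _ _)) hdotZl scalerA mulrC.
apply: (@le_trans _ _ (C * \sum_(j < k) rnorm (x j) ^+ 2)); last first.
  by rewrite -[leRHS]mulr1 ler_wpM2l.
apply: (@le_trans _ _ (\sum_(i < k) C * \sum_(l <- iota 0 d)
    rnorm (\sum_(j < k) A i j (t j l *: e [::])) ^+ 2)).
  apply: ler_sum => i _; rewrite (le_trans (weighted_sum_le C0 HC _ _ _))//.
  rewrite ler_wpM2l//; under eq_bigr do rewrite vx.
  rewrite exchange_big; apply: ler_sum => l _ /=.
  by apply: fock_bessel; exact: words_range_uniq.
rewrite -mulr_sumr ler_wpM2l// exchange_big/=.
under [leRHS]eq_bigr do rewrite xn.
rewrite [leRHS]exchange_big/=; apply: ler_sum => l _.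
rewrite (le_trans (mxopnorm_le1 _))//; apply: ler_sum => j _.
by rewrite rnormZ rnorm_fvec mulr1.
Qed.

End MatrixNorm.

(** Only the vector A e_0 is read, so the map is defined on all A; Fourier coefficients serve only
    to identify its values. *)
Definition calc_map (A : F -> F) : H -> H := fun h => calc h (A (e [::])).

Lemma calc_map_cbnorm (D : set (F -> F)) (C : R) : 0 <= C -> weighted_row_le C ->
  (forall A, D A -> linear A) -> (cbnorm D calc_map <= (Num.sqrt C)%:E)%E.
Proof.
move=> C0 HC D_lin; apply: ge_ereal_sup => r [k [A [DA A1 ->]]].
apply: ge_ereal_sup => _ [x /= x1 <-]; rewrite lee_fin ler_wsqrtr//.
under eq_bigr do under eq_bigr do rewrite mxE.
by apply: calc_matrix_le => // i j; exact: D_lin.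
Qed.

Lemma calc_map_bounded A : bounded_op (calc_map A).
Proof.
split; first exact: calc_linearl.
by exists (M * rnorm (A (e [::]))) => h; rewrite mulrAC; exact: calc_le.
Qed.

End Calculus.

(** * Weighted shifts *)

(** The term g j occurs in N - j of the first N partial sums; this is the origin of the Cesaro
    factors. *)
Lemma sum_partial_sums (V : nmodType) (g : nat -> V) N :
  \sum_(k < N) \sum_(0 <= j < k.+1) g j = \sum_(0 <= j < N) g j *+ (N - j).
Proof.
elim: N => [|N ih]; first by rewrite big_ord0 big_nil.
rewrite big_ord_recr/= ih [RHS]big_nat_recr//= subSnn mulr1n.
rewrite big_nat_recr//= addrA; congr (_ + _).
rewrite -big_split/= !big_nat; apply: eq_bigr => j /andP[_ jN].
by rewrite subSn 1?ltnW// mulrSr.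
Qed.

Section Shifts.
Variables (R : realType) (n : nat) (F : fockSpace R n) (m : nat -> R).
Hypotheses (m0 : m 0 = 1) (m_gt0 : forall k, 0 < m k).
Hypothesis mD : forall k j, m (k + j)%N <= m k * m j.
Local Notation e := (fvec F).
Local Notation "''[' x , y ]" := (hdot _ x y) : ring_scope.
Implicit Types a b : seq 'I_n.

(** These ratios telescope along a word. On the empty word the predecessor of 0 is 0, which gives
    the weight 1. *)
Definition length_weight a : R := m (size a) / m (size a).-1.

Let m_neq0 k : m k != 0. Proof. by rewrite gt_eqF. Qed.

Lemma bmu_length_weight a : bmu length_weight a = m (size a).
Proof. by elim: a => [|i a /= ->]; rewrite ?m0// /length_weight/= divfK. Qed.

Let ratio_le k j : m (k + j)%N / m j <= m k.
Proof. by rewrite ler_pdivrMr. Qed.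

Lemma admissible_length_weight : admissible_weights length_weight.
Proof.
split; first by rewrite /length_weight/= divff.
  by move=> a; rewrite divr_gt0.
move=> i; split; exists (m 1) => _ [a _ <-].
  exact: (ratio_le 1 (size a)).
by rewrite !bmu_length_weight size_rcons; exact: (ratio_le 1 (size a)).
Qed.

(** Common source of the left and right shifts, for which s adds a letter at one end. *)
Lemma fock_injection (s : seq 'I_n -> seq 'I_n) (w : seq 'I_n -> R) (C : R) :
  injective s -> (forall a, 0 <= w a <= C) ->
  exists L : F -> F, bounded_op L /\ forall a, L (e a) = (w a)%:C *: e (s a).
Proof.
move=> s_inj w_bd.
have [] := @fock_synthesis _ _ F F (fun a => (w a)%:C *: e (s a)) (C ^+ 2).
- exact: sqr_ge0.
- move=> p q c; under eq_bigr do rewrite scalerA.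
  rewrite (orthonormal_sum_sqr (f := e \o s)) ?words_range_uniq//; last first.
    by move=> a b _ _ /=; rewrite fvec_orthonormal (inj_eq s_inj).
  rewrite mulr_sumr; apply: ler_sum => a _; have /andP[w0 wC] := w_bd a.
  rewrite rnormM rnormC exprMn mulrC ler_wpM2r ?sqr_ge0//.
  by rewrite ger0_norm// lerXn2r ?nnegrE// (le_trans w0).
by move=> L [lL LC Le _]; exists L; split=> //; split=> //; exists (Num.sqrt (C ^+ 2)).
Qed.

Lemma weighted_shift_exists :
  exists W : 'I_n -> F -> F, weighted_shift length_weight W.
Proof.
suff /choice [W WP] : forall i, exists L : F -> F, bounded_op L /\
    forall a, L (e a) = (length_weight (i :: a))%:C *: e (i :: a) by exists W.
move=> i; apply: (@fock_injection (cons i) _ (m 1)); first by move=> a b [].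
by move=> a; rewrite divr_ge0 ?(ltW (m_gt0 _))//=; exact: (ratio_le 1 (size a)).
Qed.

(** The ratios are those of W at the same length, which is what makes L i commute with W. *)
Lemma right_shift_exists : exists L : 'I_n -> F -> F, forall i,
  bounded_op (L i) /\
  forall a, L i (e a) = (m (size a).+1 / m (size a))%:C *: e (rcons a i).
Proof.
suff /choice [L LP] : forall i, exists L : F -> F, bounded_op L /\
    forall a, L (e a) = (m (size a).+1 / m (size a))%:C *: e (rcons a i) by exists L.
move=> i; apply: (@fock_injection (rcons^~ i) _ (m 1)).
  by move=> a b /rcons_inj[].
by move=> a; rewrite divr_ge0 ?(ltW (m_gt0 _))//=; exact: (ratio_le 1 (size a)).
Qed.

Variable W : 'I_n -> F -> F.
Hypothesis W_shift : weighted_shift length_weight W.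

Let W_bounded i : bounded_op (W i). Proof. exact: (W_shift i).1. Qed.

Lemma opword_shift a b :
  opword W a (e b) = (m (size a + size b)%N / m (size b))%:C *: e (a ++ b).
Proof.
elim: a => [|i a ih] /=; first by rewrite add0n divff// scale1r.
rewrite ih (linear_opZ _ _ (W_bounded i).1) (W_shift i).2 scalerA -rmorphM/=.
congr (_%:C *: _); rewrite /length_weight/= size_cat addSn; field.
by rewrite !m_neq0.
Qed.

Lemma row_norm_shift (n_gt0 : (0 < n)%N) k : row_norm W k = m k ^+ 2.
Proof.
have ad a b x : '[adjoint (opword W a) x, e b] =
    (m (size a + size b)%N / m (size b))%:C * '[x, e (a ++ b)].
  rewrite -adjointEr ?opword_shift; last exact: opword_bounded.
  by rewrite hdotZr; congr (_ * _); apply/eqP; rewrite eq_complex/= oppr0 !eqxx.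
apply/le_anti/andP; split.
  (* Upper bound: the coefficients m (k + |b|) / m |b| are at most m k, and the words ab with |a| =
     k are distinct, so Parseval for each adjoint followed by Bessel for x concludes. *)
  apply: row_norm_le => // [|x]; first exact: sqr_ge0.
  apply: (cvgn_le_const (u := fun N => \sum_(a <- words n k)
    \sum_(b <- words_range n 0 N) rnorm ('[adjoint (opword W a) x, e b] : R[i]^o) ^+ 2)).
    by apply: cvg_finite_sum => a; exact: fock_parseval.
  move=> N; apply: (@le_trans _ _ (m k ^+ 2 *
    \sum_(c <- [seq a ++ b | a <- words n k, b <- words_range n 0 N])
      rnorm ('[x, e c] : R[i]^o) ^+ 2)).
    rewrite big_allpairs_dep mulr_sumr big_seq [leRHS]big_seq.
    apply: ler_sum => a; rewrite mem_words => /eqP <-.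
    rewrite mulr_sumr; apply: ler_sum => b _.
    rewrite ad rnormM rnormC exprMn ler_wpM2r ?sqr_ge0// ger0_norm; last first.
      by rewrite divr_ge0// ltW.
    by rewrite lerXn2r ?nnegrE ?divr_ge0 ?(ltW (m_gt0 _)).
  rewrite ler_wpM2l ?sqr_ge0// fock_bessel//.
  exact/words_cat_uniq/words_range_uniq.
(* Lower bound: for a power of one letter, the adjoint of W_a maps e_a to a vector with coefficient
   m k on e_0. *)
pose a := nseq k (Ordinal n_gt0).
have sa : size a = k by rewrite size_nseq.
have := row_form_le W_bounded k (e a); rewrite rnorm_fvec expr1n mulr1.
apply: le_trans; rewrite /row_form (bigD1_seq a)/= ?words_uniq ?mem_words ?sa//.
rewrite -[leLHS]addr0 lerD//; last by apply: sumr_ge0 => b _; exact: sqr_ge0.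
rewrite lerXn2r ?nnegrE ?rnorm_ge0 ?(ltW (m_gt0 _))//.
have := hdot_le (adjoint (opword W a) (e a)) (e [::]).
rewrite ad cats0 fvec_orthonormal eqxx mulr1 rnormC rnorm_fvec mulr1 sa addn0 m0 divr1.
by rewrite gtr0_norm.
Qed.

Lemma opseries_fvec c N b : opseries W c N (e b) =
  \sum_(a <- words_range n 0 N.+1)
    (c a * (m (size a + size b)%N / m (size b))%:C) *: e (a ++ b).
Proof.
rewrite opseriesE; apply: eq_bigr => a _.
by rewrite opword_shift scalerA.
Qed.

Lemma opseries_linear c N : linear (opseries W c N).
Proof.
move=> d x y; rewrite !opseriesE scaler_sumr -big_split/=; apply: eq_bigr => a _.
by rewrite (opword_bounded W_bounded a).1 scalerDr !scalerA mulrC.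
Qed.

(** * The Hardy algebra as the commutant of the weighted right shifts *)

Section RightShift.
Variable L : 'I_n -> F -> F.
Hypothesis L_bounded : forall i, bounded_op (L i).
Hypothesis L_fvec : forall i a,
  L i (e a) = (m (size a).+1 / m (size a))%:C *: e (rcons a i).

Lemma opseries_right_shift c N i b :
  opseries W c N (L i (e b)) = L i (opseries W c N (e b)).
Proof.
rewrite L_fvec (linear_opZ _ _ (opseries_linear c N)) !opseries_fvec.
rewrite (linear_op_sum _ _ _ (L_bounded i).1) scaler_sumr; apply: eq_bigr => a _.
rewrite (linear_opZ _ _ (L_bounded i).1) L_fvec !scalerA rcons_cat size_cat size_rcons.
congr (_ *: _); rewrite mulrCA -!mulrA; congr (_ * _).
rewrite -!rmorphM/= addnS; congr (_%:C).
by field; rewrite !m_neq0.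
Qed.

Lemma fvec_lspan a : lspan (range e) (e a).
Proof.
exists 1%N, (fun=> 1), (fun=> e a); split; first by exists a.
by rewrite big_ord1 scale1r.
Qed.

Lemma hardy_right_shift A i x : hardy_algebra W A -> A (L i x) = L i (A x).
Proof.
move=> [c [bA cA]].
have [M M0 AM] := bounded_op_ge0 bA; have [K K0 LK] := bounded_op_ge0 (L_bounded i).
have [bAL [M1 AL1]] := bounded_op_comp bA (L_bounded i).
have [bLA [M2 AL2]] := bounded_op_comp (L_bounded i) bA.
suff /(congr1 (@^~ x)) : A \o L i = L i \o A by [].
apply: (fock_linear_ext bAL AL1 bLA AL2) => b /=.
have h := linear_bounded_cvg (L_bounded i).1 LK (cA _ (fvec_lspan b)).
apply: (rcvg_uniq _ h); under eq_fun do rewrite -opseries_right_shift.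
rewrite L_fvec (linear_opZ _ _ bA.1).
under eq_fun do rewrite (linear_opZ _ _ (opseries_linear c _)).
by apply: cvgZl_tmp; apply: cA; exact: fvec_lspan.
Qed.

(* Such a B is determined by B e_0, as e_b is a multiple of a product of right
   shifts applied to e_0. *)
Lemma right_shift_hardy B : bounded_op B ->
  (forall i x, B (L i x) = L i (B x)) -> hardy_algebra W B.
Proof.
(* Since W_a e_0 = m |a| e_a, these coefficients are forced by the expansion of B e_0. *)
move=> bB BL; pose c a := '[B (e [::]), e a] * ((m (size a))^-1)%:C.
exists c; split=> //.
suff h b : (fun N => opseries W c N (e b)) @ \oo --> B (e b).
  move=> p [k [d [v [ve ->]]]].
  rewrite (linear_op_sum _ _ _ bB.1).
  under eq_fun do rewrite (linear_op_sum _ _ _ (opseries_linear c _)).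
  apply: cvg_finite_sum => j; rewrite (linear_opZ _ _ bB.1).
  under eq_fun do rewrite (linear_opZ _ _ (opseries_linear c _)).
  by apply: cvgZl_tmp; have [b _ <-] := ve j.
elim/last_ind: b => [|b i ih].
  have -> : (fun N => opseries W c N (e [::])) =
      (fun N => fock_trunc N.+1 (B (e [::]))).
    apply/funext => N; rewrite opseries_fvec; apply: eq_bigr => a _.
    rewrite cats0 addn0 m0 divr1 -mulrA -rmorphM/= mulVf// mulr1//.
  (* [opseries] at N includes the words of length N, [fock_trunc] at N does not. *)
  rewrite (cvg_shiftS (fun N => fock_trunc N (B (e [::])))).
  exact: fock_trunc_cvg.
have eb : e (rcons b i) = (m (size b) / m (size b).+1)%:C *: L i (e b).
  rewrite L_fvec scalerA -rmorphM/= mulf_div [m (size b) * _]mulrC divff ?scale1r//.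
  by rewrite mulf_neq0.
rewrite eb (linear_opZ _ _ bB.1) BL.
under eq_fun do rewrite (linear_opZ _ _ (opseries_linear c _)) opseries_right_shift.
apply: cvgZl_tmp; have [K K0 LK] := bounded_op_ge0 (L_bounded i).
exact: linear_bounded_cvg (L_bounded i).1 LK _ _ ih.
Qed.

End RightShift.

(** * Intertwining of W and T by the calculus *)

Section ShiftCalculus.
Variables (H : hilbert R) (T : 'I_n -> H -> H).
Hypothesis T_bounded : forall i, bounded_op (T i).
Variables (calc : H -> F -> H) (M : R).
Hypothesis M_ge0 : 0 <= M.
Hypothesis calc_linear : forall h, linear (calc h).
Hypothesis calc_le : forall h v, rnorm (calc h v) <= M * rnorm h * rnorm v.
Hypothesis calc_fvec : forall h a,
  calc h (e a) = ((m (size a))^-1)%:C *: opword T a h.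
Hypothesis calc_cvg : forall h v, (fun N => \sum_(a <- words_range n 0 N)
  '[v, e a] *: (((m (size a))^-1)%:C *: opword T a h)) @ \oo --> calc h v.

(** calc h sends W_a e_b to T_a T_b h / m |b|. For b empty this is property (i). *)
Lemma calc_opseries c N h b : calc h (opseries W c N (e b)) =
  ((m (size b))^-1)%:C *: opseries T c N (opword T b h).
Proof.
rewrite opseries_fvec (linear_op_sum _ _ _ (calc_linear h)) opseriesE scaler_sumr.
apply: eq_bigr => a _; rewrite (linear_opZ _ _ (calc_linear h)) calc_fvec.
rewrite size_cat opword_cat !scalerA; congr (_ *: _).
rewrite -mulrA -rmorphM/= [RHS]mulrC; congr (_ * _%:C).
by field; rewrite !m_neq0.
Qed.

Lemma calc_fourier c A h : fourier_rep W c A ->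
  (fun N => opseries T c N h) @ \oo --> calc h (A (e [::])).
Proof.
move=> [bA cA].
have := linear_bounded_cvg (calc_linear h) (calc_le h) (cA _ (fvec_lspan [::])).
by under eq_fun do rewrite calc_opseries m0 invr1 scale1r.
Qed.

Lemma calc_mult A h v : hardy_algebra W A ->
  calc h (A v) = calc (calc h v) (A (e [::])).
Proof.
move=> hA; have [c cA] := hA; have [K K0 AK] := bounded_op_ge0 cA.1.
have lin1 : linear (fun v => calc h (A v)).
  by move=> d x y; rewrite cA.1.1 calc_linear.
have le1 x : rnorm (calc h (A x)) <= M * rnorm h * K * rnorm x.
  rewrite (le_trans (calc_le _ _))// -[leRHS]mulrA ler_wpM2l//.
  by rewrite mulr_ge0 ?rnorm_ge0.
have lin2 : linear (fun v => calc (calc h v) (A (e [::]))).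
  by move=> d x y; rewrite calc_linear (calc_linearl T_bounded calc_cvg).
have le2 x : rnorm (calc (calc h x) (A (e [::]))) <=
    M * (M * rnorm h) * rnorm (A (e [::])) * rnorm x.
  rewrite (le_trans (calc_le _ _))//.
  have -> : M * (M * rnorm h) * rnorm (A (e [::])) * rnorm x =
    M * (M * rnorm h * rnorm x) * rnorm (A (e [::])) by ring.
  by rewrite ler_wpM2r ?rnorm_ge0// ler_wpM2l.
suff /(congr1 (@^~ v)) : (fun v => calc h (A v)) =
    (fun v => calc (calc h v) (A (e [::]))) by [].
apply: (fock_linear_ext lin1 le1 lin2 le2) => b /=.
rewrite calc_fvec.
have h1 := linear_bounded_cvg (calc_linear h) (calc_le h) (cA.2 _ (fvec_lspan b)).
apply: (rcvg_uniq h1); under eq_fun do rewrite calc_opseries.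
rewrite (linear_opZ _ _ (calc_linearl T_bounded calc_cvg (A (e [::])))).
by apply: cvgZl_tmp; exact: calc_fourier.
Qed.

Lemma cesaroE c N h : Defs.cesaro T c N h =
  (N.+1%:R^-1)%:C *: \sum_(k < N.+1) opseries T c k h.
Proof.
rewrite /Defs.cesaro opseriesE big_words_range.
under [in RHS]eq_bigr do rewrite opseriesE big_words_range.
rewrite sum_partial_sums scaler_sumr !big_nat; apply: eq_bigr => j /andP[_ jN].
rewrite -[X in _ *: X]scaler_nat scalerA scaler_sumr big_seq [RHS]big_seq.
apply: eq_bigr => a; rewrite mem_words => /eqP ->; rewrite scalerA; congr (_ * _ *: _).
have N0 : N.+1%:R != 0 :> R[i] by rewrite pnatr_eq0.
rewrite natrB 1?ltnW// mulrBr rmorphV ?unitfE ?pnatr_eq0//= rmorph_nat.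
by rewrite mulVf// mulrC.
Qed.

Lemma calc_cesaro c A h : fourier_rep W c A ->
  (fun N => Defs.cesaro T c N h) @ \oo --> calc h (A (e [::])).
Proof.
move=> cA; under eq_fun do rewrite cesaroE.
by apply: (@cvg_vector_mean _ _ (fun k => opseries T c k h)); exact: calc_fourier.
Qed.


End ShiftCalculus.

End Shifts.

(** * The inequality sum 1 / k^2 <= pi^2 / 6 *)

Section Basel.
Variable R : realType.
Implicit Types x y : R.

Lemma sin_le_id x : 0 <= x -> sin x <= x.
Proof.
move=> x0; have [|c _] := @MVT_segment R sin cos 0 x x0.
  by apply: continuous_subspaceT => y; exact: continuous_sin.
rewrite sin0 !subr0 => ->; rewrite ler_piMl// cos_le1//.
Qed.

(** This is sin^2 + cos^2 = 1 divided by 4 sin^2 cos^2. *)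
Lemma inv_sin_sqr_double x : 0 < x < pi / 2 ->
  (sin (x *+ 2)) ^- 2 = ((sin x) ^- 2 + (sin (pi / 2 - x)) ^- 2) / 4.
Proof.
move=> /andP[x0 xpi].
have s0 : sin x != 0 by rewrite gt_eqF// sin_gt0_pihalf// x0.
have sE : sin (pi / 2 - x) = cos x by rewrite sinB sin_pihalf cos_pihalf; ring.
have c0 : cos x != 0.
  by rewrite gt_eqF// cos_gt0_pihalf// xpi andbT (lt_trans _ x0)// oppr_lt0
    divr_gt0 ?pi_gt0.
rewrite sE sin_mulr2n.
have : sin x ^+ 2 + cos x ^+ 2 = 1 by rewrite addrC cos2Dsin2.
move: (sin x) (cos x) s0 c0 => s c s0 c0 sc.
apply: (@mulIf _ ((s * c) ^+ 2 *+ 4)).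
  by rewrite mulrn_eq0/= expf_neq0// mulf_neq0.
transitivity (1 : R); first by field; rewrite s0 c0.
by transitivity (s ^+ 2 + c ^+ 2); [rewrite sc|field; rewrite s0 c0].
Qed.

(* The angles (2 k + 1) pi / 2^(N + 2), k < 2^N, are stable under
   x |-> pi / 2 - x, and halving them yields half of the next family.  By the
   duplication formula, the sum of the 1 / sin^2 is multiplied by 4 when N
   increases; then sin x <= x gives the bound on the sum over odd integers. *)
Definition odd_angle N k : R := k.*2.+1%:R * pi / (2 ^+ N.+2).

Lemma odd_angle_gt0 N k : 0 < odd_angle N k.
Proof. by rewrite divr_gt0 ?exprn_gt0// mulr_gt0 ?pi_gt0// ltr0Sn. Qed.

Lemma odd_angleS N k : odd_angle N.+1 k *+ 2 = odd_angle N k.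
Proof. by rewrite /odd_angle [in LHS]exprS; field; rewrite expf_neq0. Qed.

Lemma odd_angle_rev N k : (k < 2 ^ N)%N ->
  odd_angle N (2 ^ N - k.+1) = pi / 2 - odd_angle N k.
Proof.
move=> kN; rewrite /odd_angle.
have -> : (2 ^ N - k.+1).*2.+1%:R = 2 ^+ N.+1 - k.*2.+1%:R :> R.
  have -> : (2 ^ N - k.+1).*2.+1 = (2 ^ N.+1 - k.*2.+1)%N.
    by rewrite expnS mul2n doubleB doubleS subnSK// -doubleS leq_double.
  rewrite natrB ?natrX// expnS mul2n ltn_double//.
by rewrite !exprS; field; rewrite expf_neq0.
Qed.

Lemma odd_angle_lt N k : (k < 2 ^ N)%N -> odd_angle N k < pi / 2.
Proof.
by move=> kN; rewrite -subr_gt0 -odd_angle_rev// odd_angle_gt0.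
Qed.

Lemma sum_inv_sin_sqr N :
  \sum_(0 <= k < 2 ^ N) (sin (odd_angle N k)) ^- 2 = 2 * 4 ^+ N.
Proof.
elim: N => [|N ih].
  rewrite expn0 big_nat1 mulr1.
  (* The only angle is pi / 4, fixed by the reflection; duplication reads 1 = 2 X / 4 for its term
     X. *)
  have h : 0 < odd_angle 0 0 < pi / 2 by rewrite odd_angle_gt0 odd_angle_lt.
  have := inv_sin_sqr_double h; rewrite -odd_angle_rev//=.
  have -> : odd_angle 0 0 *+ 2 = pi / 2 by rewrite /odd_angle double0; field.
  rewrite sin_pihalf expr1n invr1; lra.
(* The second half of the angles is reflected onto the first; an angle and its mirror image together
   contribute 4 times the term of the double angle. *)
rewrite (@big_cat_nat _ _ _ (2 ^ N)) ?leq_exp2l//=.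
rewrite [X in _ + X]big_nat_rev/= -{2}[(2 ^ N)%N]add0n.
rewrite [X in _ + X]big_addn.
have -> : (2 ^ N.+1 - 2 ^ N = 2 ^ N)%N by rewrite expnS mul2n -addnn addnK.
rewrite -big_split/= exprS mulrCA -ih mulr_sumr !big_nat.
apply: eq_bigr => k /andP[_ kN].
have kN1 : (k < 2 ^ N.+1)%N by rewrite (ltn_trans kN)// ltn_exp2l.
have -> : (2 ^ N + 2 ^ N.+1 - (k + 2 ^ N).+1 = 2 ^ N.+1 - k.+1)%N.
  by rewrite -addSn [(k.+1 + _)%N]addnC subnDl.
rewrite odd_angle_rev// -(odd_angleS N k) inv_sin_sqr_double ?odd_angle_gt0 ?odd_angle_lt//.
by rewrite [RHS]mulrC divfK.
Qed.

Lemma sum_inv_odd_sqr K :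
  \sum_(0 <= k < K) (k.*2.+1%:R ^+ 2)^-1 <= pi ^+ 2 / 8 :> R.
Proof.
pose N := K.
have KN : (K <= 2 ^ N)%N by apply: ltnW; exact: ltn_expl.
have pi0 : 0 < pi :> R := pi_gt0 R.
apply: (@le_trans _ _ (\sum_(0 <= k < 2 ^ N) (k.*2.+1%:R ^+ 2)^-1)).
  rewrite (big_cat_nat (leq0n K) KN)/= lerDl; apply: sumr_ge0 => k _.
  by rewrite invr_ge0 sqr_ge0.
(* The factor pi^2 / 4^(N + 2) turns the inverse square of [odd_angle N k] into 1 / (2 k + 1)^2. *)
have := sum_inv_sin_sqr N => /(congr1 (fun x => x * (pi ^+ 2 / (4 ^+ N * 16)))).
have -> : 2 * 4 ^+ N * (pi ^+ 2 / (4 ^+ N * 16)) = pi ^+ 2 / 8 :> R.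
  by field; rewrite expf_neq0.
move=> <-; rewrite mulr_suml !big_nat; apply: ler_sum => k /andP[_ kN].
have th0 := odd_angle_gt0 N k; have thN := odd_angle_lt kN.
have s0 : 0 < sin (odd_angle N k) by rewrite sin_gt0_pihalf// th0.
apply: (@le_trans _ _ ((odd_angle N k) ^- 2 * (pi ^+ 2 / (4 ^+ N * 16)))).
  have p4 : 4 ^+ N = (2 ^+ N) ^+ 2 :> R.
    by rewrite -exprM mulnC exprM; congr (_ ^+ _); ring.
  have p2 : 2 ^+ N.+2 = 2 ^+ N * 4 :> R by rewrite !exprS; ring.
  rewrite /odd_angle p4 p2 [leRHS](_ : _ = (k.*2.+1%:R ^+ 2)^-1)//.
  have q0 : 2 ^+ N != 0 :> R by rewrite expf_neq0.
  have pin0 : pi != 0 :> R by rewrite gt_eqF.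
  have o0 : k.*2.+1%:R != 0 :> R by rewrite pnatr_eq0.
  move: (2 ^+ N) (pi : R) (k.*2.+1%:R) q0 pin0 o0 => q p o q0 p0 o0.
  by field; rewrite q0 p0 o0.
apply: ler_wpM2r; first by rewrite divr_ge0 ?sqr_ge0// mulr_ge0// exprn_ge0.
rewrite lef_pV2 ?posrE ?exprn_gt0//; apply: lerXn2r.
- by rewrite nnegrE ltW.
- by rewrite nnegrE ltW.
- exact/sin_le_id/ltW.
Qed.

Lemma sum_even_odd (f : nat -> R) K :
  \sum_(0 <= k < K.*2) f k = \sum_(0 <= k < K) f k.*2 + \sum_(0 <= k < K) f k.*2.+1.
Proof.
elim: K => [|K ih]; first by rewrite !big_nil addr0.
by rewrite doubleS !big_nat_recr//= ih; ring.
Qed.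

(** Splitting odd from even gives B K <= B (2 K) <= pi^2 / 8 + B K / 4, an inequality between finite
    sums that is solved for B K. *)
Lemma sum_inv_sqr K : \sum_(0 <= k < K) (k.+1%:R ^+ 2)^-1 <= pi ^+ 2 / 6 :> R.
Proof.
set B := fun K => \sum_(0 <= k < K) (k.+1%:R ^+ 2)^-1 : R.
have BK : B K <= B K.*2.
  have KK : (K <= K.*2)%N by rewrite -addnn leq_addr.
  rewrite /B (big_cat_nat (leq0n K) KK)/= lerDl; apply: sumr_ge0 => k _.
  by rewrite invr_ge0 sqr_ge0.
have : B K.*2 <= pi ^+ 2 / 8 + B K / 4.
  rewrite /B sum_even_odd lerD ?sum_inv_odd_sqr// mulr_suml ler_sum// => k _.
  rewrite -doubleS -muln2 natrM; rewrite le_eqVlt; apply/orP; left; apply/eqP.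
  have : k.+1%:R != 0 :> R by rewrite pnatr_eq0.
  by move: k.+1%:R => o o0; field.
rewrite -/(B K); lra.
Qed.

End Basel.

(** * Choice of the weights, spectra *)

Section Weights.
Variable R : realType.

Definition root_cvg (r : nat -> R) (l : \bar R) :=
  (fun k => poweR (r k)%:E (k.*2%:R^-1)) @ \oo --> l.

Lemma root_nat_cvg1 :
  (fun k => (k.+1%:R ^+ 2 : R) `^ (k.*2%:R^-1)) @ \oo --> (1 : R).
Proof.
have E : (fun k => (k.+2%:R ^+ 2 : R) `^ (k.+1.*2%:R^-1)) =
    (fun k => expR (ln k.+2%:R / k.+1%:R)).
  apply/funext => k; rewrite /powR sqrf_eq0 pnatr_eq0/= lnXn ?ltr0Sn//.
  congr expR; rewrite -muln2 natrM -[ln _ *+ 2]mulr_natr.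
  have : k.+1%:R != 0 :> R by rewrite pnatr_eq0.
  by move: k.+1%:R (ln _) => o t o0; field.
suff : (fun k => expR (ln k.+2%:R / k.+1%:R)) @ \oo --> expR (0 : R).
  by rewrite expR0 -E => h; rewrite -cvg_shiftS; exact: h.
suff h : (fun k => ln k.+2%:R / k.+1%:R) @ \oo --> (0 : R).
  exact: (cvg_comp _ _ h (@continuous_expR R 0)).
(* From ln x <= x at x = sqrt (k + 2) comes ln (k + 2) <= 2 sqrt (k + 2); after squaring, 4 (k + 2)
   <= 16 (k + 1) explains the 16. *)
apply: (squeeze_cvgr (f := fun=> 0) (h := fun k => Num.sqrt (16 * k.+1%:R^-1))).
- apply: nearW => k; rewrite divr_ge0 ?ln_ge0 ?ler1n//=.
  have k0 : 0 < k.+1%:R :> R by rewrite ltr0Sn.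
  rewrite ler_pdivrMr//.
  have -> : ln k.+2%:R = ln (Num.sqrt k.+2%:R) *+ 2 :> R.
    by rewrite -lnXn ?sqrtr_gt0 ?ltr0Sn// sqr_sqrtr// ler0n.
  apply: (@le_trans _ _ (Num.sqrt k.+2%:R *+ 2)).
    by rewrite lerMn2r/= ltW// ln_sublinear// sqrtr_gt0 ltr0Sn.
  rewrite -(@ler_pXn2r _ 2) ?nnegrE ?mulrn_wge0 ?mulr_ge0 ?sqrtr_ge0//.
  have q2 : Num.sqrt k.+2%:R ^+ 2 = k.+1%:R + 1 :> R.
    by rewrite sqr_sqrtr ?ler0n// natr1.
  rewrite [leRHS]exprMn [X in _ <= X * _]sqr_sqrtr; last first.
    by rewrite mulr_ge0// invr_ge0.
  have -> : 16 * k.+1%:R^-1 * k.+1%:R ^+ 2 = 16 * k.+1%:R :> R.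
    by rewrite -mulrA expr2 mulKf ?gt_eqF.
  have : 1 <= k.+1%:R :> R by rewrite ler1n.
  move: q2; move: (k.+1%:R : R) (Num.sqrt _) => o q; nra.
- exact: cvg_cst.
- have h : (fun k => 16 * k.+1%:R^-1) @ \oo --> (0 : R).
    by rewrite -[X in _ --> X](mulr0 16); apply: cvgMl_tmp; exact: cvg_harmonic0.
  by have := cvg_comp _ _ h (@sqrt_continuous R 0); rewrite sqrtr0.
Qed.

(** The roots are multiplied by a sequence t tending to 1, or by its inverse; the product of 1 with
    any extended real is defined, so infinite limits are covered. *)
Lemma root_cvg_scale (r : nat -> R) (l : \bar R) : (forall k, 0 <= r k) ->
  root_cvg (fun k => k.+1%:R ^+ 2 * r k) l <-> root_cvg r l.
Proof.
move=> r0; pose t k := (k.+1%:R ^+ 2 : R) `^ (k.*2%:R^-1).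
have tk k : 0 < t k by rewrite powR_gt0// exprn_gt0// ltr0Sn.
have t1 : (fun k => (t k)%:E) @ \oo --> 1%E.
  by apply: cvg_EFin; [exact: nearW|exact: root_nat_cvg1].
have tV1 : (fun k => (t k)^-1%:E) @ \oo --> 1%E.
  apply: cvg_EFin; first exact: nearW.
  by rewrite -[X in _ --> X]invr1; apply: cvgV; rewrite ?oner_eq0//; exact: root_nat_cvg1.
have E : (fun k => poweR (k.+1%:R ^+ 2 * r k)%:E (k.*2%:R^-1)) =
    (fun k => (t k)%:E * poweR (r k)%:E (k.*2%:R^-1))%E.
  by apply/funext => k; rewrite !poweR_EFin powRM ?sqr_ge0.
have E' : (fun k => poweR (r k)%:E (k.*2%:R^-1)) = (fun k =>
    (t k)^-1%:E * poweR (k.+1%:R ^+ 2 * r k)%:E (k.*2%:R^-1))%E.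
  apply/funext => k; rewrite !poweR_EFin powRM ?sqr_ge0// -EFinM mulrA mulVf ?mul1r//.
  by rewrite gt_eqF.
have md (x : \bar R) : mule_def 1%E x.
  by case: x => [x||]; rewrite /mule_def ?oner_neq0.
by rewrite /root_cvg; split=> h; rewrite -(mul1e l) ?E ?[X in X @ _ --> _]E';
  apply: cvgeM.
Qed.

(* Here r k stands for b_k^2, and root_cvg r l means b_k^(1/k) --> l. *)
Lemma weights_exist (r : nat -> R) : (forall k, 0 <= r k) -> r 0 <= 1 ->
  (forall k j, r (k + j)%N <= r k * r j) ->
  exists m : nat -> R, [/\ m 0 = 1, forall k, 0 < m k,
    forall k j, m (k + j)%N <= m k * m j,
    forall k, k.+1%:R ^+ 2 * r k <= m k ^+ 2 &
    forall l, root_cvg (fun k => m k ^+ 2) l <-> root_cvg r l].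
Proof.
move=> r0 r01 rD.
have [r_gt0|] := pselect (forall k, 0 < r k).
  have r00 : r 0 = 1.
    apply/le_anti; rewrite r01/= -(ler_pM2l (r_gt0 0)) mulr1; exact: (rD 0 0).
  exists (fun k => k.+1%:R * Num.sqrt (r k)); split.
  - by rewrite r00 sqrtr1 mul1r.
  - by move=> k; rewrite mulr_gt0 ?ltr0Sn// sqrtr_gt0.
  - move=> k j; rewrite mulrACA ler_pM ?ler0n ?sqrtr_ge0//.
      by rewrite -natrM ler_nat mulSn mulnS addnA addSn ltnS [(k + j)%N]addnC leq_addr.
    by rewrite -sqrtrM// ler_wsqrtr.
  - by move=> k; rewrite exprMn sqr_sqrtr.
  - move=> l; have -> : (fun k => (k.+1%:R * Num.sqrt (r k)) ^+ 2) =
        (fun k => k.+1%:R ^+ 2 * r k).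
      by apply/funext => k; rewrite exprMn sqr_sqrtr.
    exact: root_cvg_scale.
move/existsNP => [K /negP]; rewrite -leNgt => rK.
have rk0 k : (K <= k)%N -> r k = 0.
  move=> Kk; apply/le_anti; rewrite r0 andbT -(subnKC Kk) (le_trans (rD _ _))//.
  by rewrite mulr_le0_ge0.
(* The weights will be m k = (C / 2^k)^k. The base decreases in k, whence submultiplicativity, and
   tends to 0. As r vanishes from K on, the lower bound matters for k < K only, where C / 2^k >= 2 D
   and so m k^2 >= (2 D)^(2 k) >= (k + 1)^2 D^k. *)
pose D := r 1 + 1; pose C := 2 ^+ K.+1 * D.
have D1 : 1 <= D by rewrite /D lerDr.
have C1 : 1 <= C by rewrite -[1]mulr1 ler_pM// exprn_ege1// ler1n.
have C0 : 0 < C by rewrite (lt_le_trans _ C1).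
have half_gt0 k : 0 < C / 2 ^+ k by rewrite divr_gt0// exprn_gt0.
have rkD k : r k <= D ^+ k.
  elim: k => [|k ih]; first by rewrite expr0.
  rewrite exprS -add1n (le_trans (rD _ _))// ler_pM//.
  by rewrite /D lerDl.
exists (fun k => (C / 2 ^+ k) ^+ k); split.
- by rewrite expr0.
- by move=> k; rewrite exprn_gt0.
- move=> k j; rewrite exprD ler_pM ?exprn_ge0 ?(ltW (half_gt0 _))//;
  rewrite lerXn2r ?nnegrE ?(ltW (half_gt0 _))// ler_pM2l// lef_pV2 ?posrE ?exprn_gt0//;
  by rewrite ler_weXn2l ?ler1n// ?leq_addr ?leq_addl.
- move=> k; have [/rk0 ->|kK] := leqP K k; first by rewrite mulr0 sqr_ge0.
  have h2 : 2 * D <= C / 2 ^+ k.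
    rewrite ler_pdivlMr ?exprn_gt0// /C mulrAC ler_wpM2r ?(le_trans _ D1)//.
    by rewrite -exprS ler_weXn2l ?ler1n// ltnW.
  have Dk : D ^+ k <= (D ^+ k) ^+ 2.
    by rewrite -exprM ler_weXn2l// muln2 -addnn leq_addr.
  have h4 : (k.+1%:R ^+ 2) * D ^+ k <= ((2 * D) ^+ k) ^+ 2.
    rewrite exprMn exprMn ler_pM ?sqr_ge0 ?exprn_ge0 ?(le_trans _ D1)//.
    rewrite lerXn2r ?nnegrE ?ler0n ?exprn_ge0// -natrX ler_nat.
    exact: ltn_expl.
  rewrite (le_trans _ (le_trans h4 _))//; first by rewrite ler_wpM2l ?sqr_ge0.
  have D20 : 0 <= 2 * D by rewrite mulr_ge0// (le_trans _ D1).
  rewrite lerXn2r ?nnegrE ?exprn_ge0 ?(ltW (half_gt0 _))//.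
  by rewrite lerXn2r ?nnegrE ?(ltW (half_gt0 _)).
(* Both sequences of roots tend to 0, so either side of the equivalence amounts to l = 0. *)
- suff [h1 h2] : root_cvg (fun k => ((C / 2 ^+ k) ^+ k) ^+ 2) 0%E /\ root_cvg r 0%E.
    move=> l; split=> h.
      by rewrite (cvg_unique (@ereal_hausdorff R) h h1).
    by rewrite (cvg_unique (@ereal_hausdorff R) h h2).
  split; last first.
    apply: cvg_near_cst; exists K.+1 => // k /= Kk.
    rewrite rk0 ?(ltnW Kk)// powR0// invr_eq0 pnatr_eq0 double_eq0 -lt0n.
    exact: leq_ltn_trans Kk.
  have E : (fun k => poweR ((C / 2 ^+ k.+1) ^+ k.+1 ^+ 2)%:E (k.+1.*2%:R^-1)) =
      (fun k => (C / 2 * (2^-1) ^+ k)%:E).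
    apply/funext => k; rewrite poweR_EFin -exprM muln2.
    rewrite -powR_mulrn ?(ltW (half_gt0 _))// -powRrM mulfV ?powRr1 ?(ltW (half_gt0 _))//.
    by rewrite exprS invfM mulrA exprVn.
  suff h : (fun k => (C / 2 * (2^-1) ^+ k)%:E) @ \oo --> 0%E.
    by rewrite -E in h; rewrite /root_cvg -cvg_shiftS; exact: h.
  apply: cvg_EFin; first exact: nearW.
  by apply: cvg_geometric; rewrite ger0_norm// invf_lt1// ltr1n.
Qed.

End Weights.

(* limn chooses a limit by means of its defining property only, so two sequences
   with the same limits get the same value even when they diverge. *)
Lemma eq_limn (T : ptopologicalType) (u v : nat -> T) :
  (forall l : T, u @ \oo --> l <-> v @ \oo --> l) -> limn u = limn v.
Proof.
by move=> uv; rewrite /lim /lim_in; congr get; apply/funext => l; exact/propext.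
Qed.

(** * Resolvents and spectral radii *)

Section Spectrum.
Variables (R : realType) (E : hilbert R) (A : E -> E) (M : R).
Hypotheses (A_lin : linear A) (M_ge0 : 0 <= M).
Hypothesis A_le : forall x, rnorm (A x) <= M * rnorm x.

(** Ensures that the supremum in [spectral_radius] is a true one and not a default value. For |l| >
    M, l - A is bounded below, hence injective, and is onto by a contraction argument. *)
Lemma spectrum_le (l : R[i]) : spectrum A l -> complex.Re `|l| <= M.
Proof.
move=> sl; rewrite leNgt; apply/negP => Ml; apply: sl.
rewrite -/(rnorm (l : R[i]^o)) in Ml; set L := rnorm (l : R[i]^o) in Ml.
have L_gt0 : 0 < L by exact: le_lt_trans Ml.
have LM : 0 < L - M by rewrite subr_gt0.
have l0 : l != 0.
  by apply: contraTneq L_gt0 => l0; rewrite /L l0 (@rnorm0 _ R[i]^o) ltxx.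
have Linv : rnorm (l^-1 : R[i]^o) = L^-1.
  by apply: complexI; rewrite fmorphV/= !rnormcE normfV.
pose S x := l *: x - A x.
have S_lin : linear S.
  by move=> c x y; rewrite /S A_lin !scalerDr !scalerN !scalerA opprD addrACA mulrC.
have S_ge x : rnorm x <= (L - M)^-1 * rnorm (S x).
  rewrite mulrC ler_pdivlMr// mulrBr.
  have : rnorm (l *: x) <= rnorm (S x) + rnorm (A x).
    by have := rnormD (S x) (A x); rewrite subrK.
  rewrite rnormZ -/L; have := A_le x; lra.
have S_inj x y : S x = S y -> x = y.
  move=> Sxy; apply/subr0_eq/rnorm_le0; rewrite (le_trans (S_ge _))//.
  by rewrite (linear_opB _ _ S_lin) Sxy subrr rnorm0 mulr0.
have S_surj y : exists x, S x = y.
  (* A fixed point of f solves l x - A x = y. The map f contracts by M / L, and K bounds its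
     iterates because |y| + M K = L K. *)
  pose f x := l^-1 *: (y + A x).
  pose x_ N := iter N f 0.
  pose K := (L - M)^-1 * rnorm y.
  have K0 : 0 <= K by rewrite mulr_ge0 ?rnorm_ge0// invr_ge0 ltW.
  have xK N : rnorm (x_ N) <= K.
    elim: N => [|N ih]; first by rewrite /x_/= rnorm0.
    rewrite /x_ iterS -/(x_ N) rnormZ Linv mulrC ler_pdivrMr//.
    rewrite (le_trans (rnormD _ _))//.
    have yE : rnorm y = (L - M) * K by rewrite /K mulVKf// gt_eqF.
    have : M * rnorm (x_ N) <= M * K by rewrite ler_wpM2l.
    by have := A_le (x_ N); rewrite yE; lra.
  have q0 : 0 <= M / L by rewrite divr_ge0// ltW.
  have fq u v : rnorm (f u - f v) <= (M / L) * rnorm (u - v).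
    rewrite /f -scalerBr rnormZ Linv opprD addrACA subrr add0r.
    by rewrite -(linear_opB _ _ A_lin) [M / L]mulrC -mulrA ler_wpM2l// invr_ge0 ltW.
  have close N k : (N <= k)%N -> rnorm (x_ k - x_ N) <= (M / L) ^+ N * K.
    move=> /subnKC <-; move: (k - N)%N => j.
    elim: N => [|N ih]; first by rewrite mul1r subr0.
    by rewrite exprS -mulrA (le_trans (fq _ _))// ler_wpM2l.
  have e0 : (fun N => (M / L) ^+ N * K) @ \oo --> (0 : R).
    rewrite -(mul0r K); apply: cvgMr_tmp.
    have := @cvg_geometric R 1 (M / L); rewrite ger0_norm//.
    rewrite ltr_pdivrMr// mul1r => /(_ Ml).
    suff -> : geometric 1 (M / L) = (fun N => (M / L) ^+ N) by [].
    by apply/funext => N; rewrite /geometric/= mul1r.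
  have /cvg_ex[x xx] := rcvg_cauchy close e0.
  exists x; have h : (fun N => f (x_ N)) @ \oo --> x.
    by rewrite -(cvg_shiftS x_) in xx; exact: xx.
  have h' : (fun N => f (x_ N)) @ \oo --> f x.
    apply/rcvg0P; apply: (squeeze_cvgr _ (cvg_cst 0)); last first.
      rewrite -(mulr0 (M / L)); apply: cvgMl_tmp; exact/rcvg0P/xx.
    by apply: nearW => N; rewrite rnorm_ge0 fq.
  rewrite /S {1}(rcvg_uniq h h') /f scalerA mulfV// scale1r addrK//.
have [B SB] := choice S_surj.
exists B; split=> //.
- split.
    by move=> c x y; apply: S_inj; rewrite S_lin !SB.
  by exists (L - M)^-1 => x; rewrite -{2}(SB x).
- by move=> x; apply: S_inj; rewrite SB.
Qed.

End Spectrum.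

(** Empty spectra are treated apart: their radius is 0, and any radius is nonnegative. *)
Lemma spectral_radius_le (R : realType) (E H : hilbert R) (A : E -> E)
    (B : H -> H) : bounded_op A -> spectrum B `<=` spectrum A ->
  spectral_radius B <= spectral_radius A.
Proof.
move=> bA BA; have [M M0 AM] := bounded_op_ge0 bA.
have ubA : has_ubound [set complex.Re `|l| | l in spectrum A].
  by exists M => _ [l lA <-]; exact: spectrum_le bA.1 M0 AM _ lA.
have radius0 (V : hilbert R) (C : V -> V) :
    spectrum C = set0 -> spectral_radius C = 0.
  by rewrite /spectral_radius => ->; rewrite image_set0 sup0.
have [B0|/set0P[l lB]] := eqVneq (spectrum B) set0; last first.
  apply: ge_sup; first by exists (complex.Re `|l|), l.
  by move=> _ [k kB <-]; apply: ub_le_sup => //; exists k => //; exact: BA.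
rewrite (radius0 _ _ B0).
have [/radius0 ->//|/set0P[l lA]] := eqVneq (spectrum A) set0.
apply: (@le_trans _ _ (complex.Re `|l|)).
  exact: (@rnorm_ge0 _ (R[i]^o)).
by apply: ub_le_sup => //; exists l.
Qed.

(** * Ultraweak functionals and their transport by the calculus *)

Section NormalFunctional.
Variables (R : realType) (E : hilbert R).
Local Notation "''[' x , y ]" := (hdot _ x y) : ring_scope.

(** On such sequences a normal functional is the vector functional <A x, y>, which extracts weak
    convergence from w*-convergence. *)
Definition single (x : E) : nat -> E := fun j => if j == 0 then x else 0.

Lemma series_single (V : zmodType) (f : nat -> V) N :
  (forall j, (0 < j)%N -> f j = 0) -> (0 < N)%N -> series f N = f 0.
Proof.
move=> f0; case: N => // N _; rewrite /series/= big_nat_recl// big1 ?addr0// => j _.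
exact: f0.
Qed.

Lemma square_summable_single x : square_summable (single x).
Proof.
apply/cvg_ex; exists (rnorm x ^+ 2); apply: cvg_near_cst.
exists 1%N => // N /= N0; rewrite series_single// => -[//|j] _.
by rewrite /single/= rnorm0 expr0n.
Qed.

Lemma normal_functional_single x y (A : E -> E) :
  normal_functional (single x) (single y) A = '[A x, y].
Proof.
apply: cvg_lim; first exact: norm_hausdorff.
apply: cvg_near_cst; exists 1%N => // N /= N0.
by rewrite series_single// => -[//|j] _; rewrite /single/= hdot0r.
Qed.

End NormalFunctional.

Section NormalRiesz.
Variables (R : realType) (F H : hilbert R) (calc : H -> F -> H) (M : R).
Local Notation "''[' x , y ]" := (hdot _ x y) : ring_scope.
Hypothesis M_ge0 : 0 <= M.
Hypothesis calc_riesz : forall h y, exists u : F,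
  (forall v, '[calc h v, y] = '[v, u]) /\ rnorm u <= M * rnorm h * rnorm y.

(** w is the sum of the Riesz vectors u j of v |-> <calc (x j) v, y j>, whose norms are at most M |x
    j| |y j|. *)
Lemma normal_functional_calc x y : square_summable x -> square_summable y ->
  exists w : F, forall B : F -> F, forall e : F,
    normal_functional x y (fun h => calc h (B e)) = '[B e, w].
Proof.
move=> sx sy.
have /choice [u uP] : forall j, exists u : F,
    (forall v, '[calc (x j) v, y j] = '[v, u]) /\
    rnorm u <= M * rnorm (x j) * rnorm (y j) by move=> j; exact: calc_riesz.
pose g j := rnorm (x j) ^+ 2 + rnorm (y j) ^+ 2.
have g0 j : 0 <= g j by rewrite addr_ge0// sqr_ge0.
have cg : cvgn (series g).
  have -> : series g = series (fun j => rnorm (x j) ^+ 2) +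
      series (fun j => rnorm (y j) ^+ 2).
    by apply/funext => N; rewrite /series/= big_split.
  exact: is_cvgD.
have ug j : rnorm (u j) <= M * g j.
  rewrite (le_trans (uP j).2)// -mulrA ler_wpM2l// /g.
  have := sqr_ge0 (rnorm (x j) - rnorm (y j)).
  by have := rnorm_ge0 (x j); have := rnorm_ge0 (y j); nra.
have nd : nondecreasing_seq (series g) by exact: nondecreasing_series.
pose G := limn (series g).
have gG N : series g N <= G by exact: nondecreasing_cvgn_le.
have G0 : 0 <= G by apply: le_trans (gG 0); rewrite /series/= big_nil.
have /cvg_ex[w ww] : cvgn (series u).
  (* For an increment D <= G of [series g], the squared increment of [series u] is at most (M D)^2
     <= M^2 G D. *)
  apply: (@rcvg_sqr_cauchy _ _ _ (M ^+ 2 * G) G (series g)) => //.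
    by rewrite mulr_ge0 ?sqr_ge0.
  move=> p q pq.
  have le1 : rnorm (series u q - series u p) <= M * (series g q - series g p).
    rewrite /series/= (big_cat_nat (leq0n p) pq)/= addrAC subrr add0r.
    rewrite (big_cat_nat (leq0n p) pq)/= addrAC subrr add0r.
    rewrite (le_trans (rnorm_sum _ _ _))// mulr_sumr; exact: ler_sum.
  have d0 : 0 <= series g q - series g p by rewrite subr_ge0 nd.
  have dG : series g q - series g p <= G.
    have : 0 <= series g p by rewrite /series/= sumr_ge0.
    by have := gG q; lra.
  apply: (@le_trans _ _ ((M * (series g q - series g p)) ^+ 2)).
    by rewrite lerXn2r ?nnegrE ?rnorm_ge0// mulr_ge0.
  rewrite exprMn -mulrA ler_wpM2l ?sqr_ge0// expr2 ler_wpM2r//.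
exists w => B e; apply: cvg_lim; first exact: norm_hausdorff.
have := hdot_cvgr (y := B e) ww.
suff -> : (fun N => '[B e, series u N]) =
    series (fun j => '[calc (x j) (B e), y j] : R[i]^o) by [].
apply/funext => N; rewrite /series/= hdot_sumr; apply: eq_bigr => j _.
by rewrite (uP j).1.
Qed.

End NormalRiesz.

Theorem theorem5p2 (R : realType) (n : nat) (n_gt0 : (0 < n)%N)
    (F : fockSpace R n) (H : hilbert R) (H_separable : separable H)
    (T : 'I_n -> H -> H) (T_bounded : forall i, bounded_op (T i)) :
  exists (mu : seq 'I_n -> R) (W : 'I_n -> F -> F),
    [/\ admissible_weights mu, weighted_shift mu W,
        joint_radius W = joint_radius T &
    exists Psi : (F -> F) -> (H -> H),
      functional_calculus W T Psi /\
      [/\ (forall c m, Psi (opseries W c m) = opseries T c m),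
          (seq_wot_continuous_on (hardy_algebra W) Psi /\
           seq_sot_continuous_on (hardy_algebra W) Psi),
          [/\ algebra_hom_on (hardy_algebra W) Psi,
              (cbnorm (hardy_algebra W) Psi < +oo)%E &
              exists S : H -> H,
                [/\ bounded_op S,
                    sot_cvg
                      ((fun N => \sum_(k < N.+1)
                          row_square T (fun a => ((bmu mu a ^+ 2)^-1)%:C) k)
                        @ \oo) S &
                    (cbnorm (hardy_algebra W) Psi
                       <= poweR (opnorm S) 2^-1)%E]],
          wstar_continuous_on (hardy_algebra W) Psi &
          (forall A, hardy_algebra W A ->
             spectral_radius (Psi A) <= spectral_radius A)] /\
      (cbnorm (hardy_algebra W) Psi <= (pi / Num.sqrt 6)%:E)%E /\
      (forall m, (2 <= m)%N -> nilpotent_of_order T m ->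
         (cbnorm (hardy_algebra W) Psi
            <= (Num.sqrt (\sum_(0 <= k < m) (k.+1%:R ^+ 2)^-1))%:E)%E)].
Proof.
have [m [m0 m_gt0 mD rm mroot]] := weights_exist (row_norm_ge0 T_bounded)
  (row_norm0_le1 T_bounded) (row_normD T_bounded).
have pi6 : 0 <= pi ^+ 2 / 6 :> R by rewrite divr_ge0// sqr_ge0.
have HC : weighted_row_le T m (pi ^+ 2 / 6).
  apply: (weighted_row_le_series T_bounded m_gt0 (s := fun k => (k.+1%:R ^+ 2)^-1)).
  - by move=> k; rewrite invr_ge0 sqr_ge0.
  - by move=> k; rewrite mulrC ler_pdivlMr ?exprn_gt0 ?ltr0Sn// mulrC.
  - exact: sum_inv_sqr.
have [W W_shift] := weighted_shift_exists F m_gt0 mD.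
have [calc [calc_linear calc_le calc_fvec calc_cvg]] :=
  calculus_exists F T_bounded m_gt0 pi6 HC.
have C0 : 0 <= Num.sqrt (pi ^+ 2 / 6 : R) by exact: sqrtr_ge0.
have Wb i : bounded_op (W i) := (W_shift i).1.
exists (length_weight m), W; split=> //.
- exact: admissible_length_weight.
(* The two [limn] agree because their sequences have the same limits; [hW] and [hT] identify these
   sequences with the ones compared by [mroot]. *)
- apply: eq_limn => l; have := mroot l.
  have [hW hT] : (forall k, opnorm (row_square W (fun=> 1) k) = (m k ^+ 2)%:E) /\
      (forall k, opnorm (row_square T (fun=> 1) k) = (row_norm T k)%:E).
    split=> k; last by have [] := row_normP T_bounded k.
    have [-> _ _ _] := row_normP Wb k.
    by rewrite (row_norm_shift m0 m_gt0 mD W_shift n_gt0).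
  rewrite /root_cvg.
  under [in X in _ -> X]eq_fun do rewrite hW.
  by under [in X in _ -> (_ <-> X)]eq_fun do rewrite hT.
have lin A : hardy_algebra W A -> linear A by move=> [c [[]]].
have cb C : 0 <= C -> weighted_row_le T m C ->
    (cbnorm (hardy_algebra W) (calc_map calc) <= (Num.sqrt C)%:E)%E.
  by move=> ? ?; apply: (calc_map_cbnorm T_bounded m_gt0 calc_cvg).
have cb_pi : (cbnorm (hardy_algebra W) (calc_map calc) <= (pi / Num.sqrt 6)%:E)%E.
  have := cb _ pi6 HC; rewrite sqrtrM ?sqr_ge0// sqrtr_sqr sqrtrV//.
  by rewrite ger0_norm// pi_ge0.
have mult := calc_mult m0 m_gt0 W_shift T_bounded C0 calc_linear calc_le calc_fvec calc_cvg.
have calc_id h : calc h (fvec F [::]) = h.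
  by rewrite calc_fvec/= m0 invr1 scale1r.
have lin_l := calc_linearl T_bounded calc_cvg.
have bPsi A : bounded_op (calc_map calc A).
  exact: (calc_map_bounded T_bounded calc_le calc_cvg).
have rz := calc_riesz calc_linear calc_le.
exists (calc_map calc); split.
  move=> c A cA; split; first exact: bPsi.
  move=> h; exact: (calc_cesaro m0 m_gt0 W_shift calc_linear calc_le calc_fvec cA).
split; last first.
  split=> // N N2 [TN _].
  apply: cb; first by apply: sumr_ge0 => k _; rewrite invr_ge0 sqr_ge0.
  (* A word of length at least N has a prefix of length N, which T kills, so row norms vanish from N
     on and the majorant is cut off there. *)
  apply: (weighted_row_le_series T_bounded m_gt0
    (s := fun k => if (k < N)%N then (k.+1%:R ^+ 2)^-1 else 0)).
  - by move=> k; case: ifP => // _; rewrite invr_ge0 sqr_ge0.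
  - move=> k; case: ltnP => [_|Nk].
      by rewrite mulrC ler_pdivlMr ?exprn_gt0 ?ltr0Sn// mulrC.
    rewrite mul0r row_norm_eq0// => a ak; apply/funext => x.
    rewrite -(cat_take_drop N a) opword_cat TN// size_takel// ak//.
  - move=> K; rewrite -big_mkcond/=.
    apply: (@le_trans _ _ (\sum_(0 <= k < maxn K N | (k < N)%N) (k.+1%:R ^+ 2)^-1)).
      rewrite (big_cat_nat (leq0n K) (leq_maxl K N))/= lerDl.
      by apply: sumr_ge0 => k _; rewrite invr_ge0 sqr_ge0.
    rewrite [leRHS](big_nat_widen _ _ (maxn K N)) ?leq_maxr//.
split.
- move=> c N; apply/funext => h; rewrite /calc_map.
  by rewrite (calc_opseries m_gt0 W_shift calc_linear calc_fvec)/= m0 invr1 scale1r.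
- split=> [u A _ _ uA x y|u A _ _ uA x].
    have [w [wP _]] := rz x y.
    have := uA (fvec F [::]) w; rewrite -wP.
    suff -> : (fun B : F -> F => hdot F (B (fvec F [::])) w : R[i]^o) =
      (fun B => hdot H (calc_map calc B x) y : R[i]^o) by [].
    by apply/funext => B; rewrite -wP.
  exact: (calc_contr calc_linear calc_le (uA (fvec F [::]))).
- split.
  + split=> [l A B _ _|A B hA _|]; apply/funext => h.
    * exact: calc_linear.
    * by rewrite /calc_map/= mult.
    * exact: calc_id.
  + exact: le_lt_trans cb_pi (ltry _).
  + have [S [bS SP]] := weighted_row_sum_exists T_bounded m_gt0 pi6 HC.
    have [b [bE b0 Sb _]] := opnormP bS.
    exists S; split=> //.
      move=> x; have := SP x; rewrite -cvg_shiftS.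
      suff -> : (fun N => weighted_row T m N.+1 x) = (fun N =>
        (\sum_(k < N.+1) row_square T (fun a => ((bmu (length_weight m) a ^+ 2)^-1)%:C) k) x) by [].
      apply/funext => N; rewrite fct_sumE /weighted_row /row_op big_words_range big_mkord.
      apply: eq_bigr => k _; rewrite row_squareE /row_op; apply: eq_bigr => a _.
      by rewrite bmu_length_weight.
    (* The cb bound is applied again, now with C the norm of S. *)
    rewrite bE poweR_EFin powR12_sqrt//; apply: cb => //.
    exact: (weighted_row_le_opnorm T_bounded m_gt0 SP Sb).
- move=> G A FG _ _ GA x y sx sy.
  have [w wP] := normal_functional_calc C0 rz sx sy.
  have := GA _ _ (@square_summable_single _ F (fvec F [::]))
    (@square_summable_single _ F w).
  rewrite normal_functional_single -wP.
  suff -> : normal_functional (single (fvec F [::])) (single w) =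
    (fun B : F -> F => normal_functional x y (calc_map calc B)) by [].
  by apply/funext => B; rewrite normal_functional_single -wP.
- move=> A hA; have [c [bA _]] := hA; apply: spectral_radius_le => //.
  move=> l; apply: contra_not => -[B [bB BA AB]].
  have [L LP] := right_shift_exists F m_gt0 mD.
  have bL i := (LP i).1; have eL i := (LP i).2.
  have LA i x := hardy_right_shift m_gt0 W_shift bL eL i x hA.
  (* The inverse B of l - A commutes with the right shifts because l - A does. Once B is in the
     Hardy algebra, [mult] makes [calc_map calc B] the inverse of l - Psi A. *)
  have hB : hardy_algebra W B.
    apply: (right_shift_hardy m0 m_gt0 W_shift bL eL bB) => i x.
    rewrite -[in LHS](AB x) (linear_opB _ _ (bL i).1) (linear_opZ _ _ (bL i).1).
    by rewrite -LA BA.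
  exists (calc_map calc B); split=> // h; rewrite /calc_map.
    rewrite (linear_opB _ _ (lin_l _)) (linear_opZ _ _ (lin_l _)) -mult//.
    rewrite -(linear_opZ _ _ (calc_linear h)) -(linear_opB _ _ (calc_linear h)).
    by rewrite -(linear_opZ _ _ bB.1) -(linear_opB _ _ bB.1) BA calc_id.
  rewrite -mult// -(linear_opZ _ _ (calc_linear h)) -(linear_opB _ _ (calc_linear h)).
  by rewrite AB calc_id.
Qed.
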